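(* Assume that $\sum_{j\in\Lambda_p^*} r_j>0$. Then, for any continuous function $G:[0,1]\to\mathbb{R}$, $$\lim_{N\to\infty} E_{\mu_N}\Big[\,\Big|\frac1N\sum_{k=1}^{N-1} G(k/N)\,[\eta_k-\bar u(k/N)]\,\Big|\,\Big]=0,$$ where $\mu_N$ is the unique stationary state of the Markov chain on $\Omega_{N,p}$ with generator $L_N=L_l+L_{0,1}+L_{b,N}+L_{r,N}$, and $\bar u:[0,1]\to\mathbb{R}$ is the unique solution of the linear equation $\Delta u=0$ on $(0,1)$, $u(0)=\rho(0)$, $u(1)=\beta$. Here $\rho(0)=E_\mu[\eta_0]$, where $\mu$ is the stationary state (unique under the present hypothesis) of the Markov chain on $\Omega_p^*$ with generator $L_l$.
   Context: Fix an integer $p\ge 0$ and $\beta\in(0,1)$. Let $\Lambda_p^*=\{-p,\dots,0\}$, $\Omega_p^*=\{0,1\}^{\Lambda_p^*}$ and, for $N\ge2$, $\Lambda_{N,p}=\{-p,\dots,N-1\}$, $\Omega_{N,p}=\{0,1\}^{\Lambda_{N,p}}$. Configurations are denoted by $\eta$, with $\eta_k\in\{0,1\}$. $\sigma^{j,k}\eta$ is the configuration obtained from $\eta$ by exchanging $\eta_j$ and $\eta_k$; $\sigma^k\eta$ is obtained by replacing $\eta_k$ by $1-\eta_k$. Fix constants (independent of $N$), for $j,k\in\Lambda_p^*$: $r_j\ge0$, $\alpha_j\in[0,1]$, $c_{j,k}\ge0$, $a_{j,k}\ge0$ with $c_{j,j}=a_{j,j}=0$. Define $$(L_Rf)(\eta)=\sum_{j\in\Lambda_p^*}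 r_j[\alpha_j(1-\eta_j)+\eta_j(1-\alpha_j)]\{f(\sigma^j\eta)-f(\eta)\},$$ $$(L_Cf)(\eta)=\sum_{j,k\in\Lambda_p^*} c_{j,k}[\eta_k(1-\eta_j)+\eta_j(1-\eta_k)]\{f(\sigma^j\eta)-f(\eta)\},$$ $$(L_Af)(\eta)=\sum_{j,k\in\Lambda_p^*} a_{j,k}[\eta_k\eta_j+(1-\eta_j)(1-\eta_k)]\{f(\sigma^j\eta)-f(\eta)\},$$ $$(L_Sf)(\eta)=\sum_{j=-p}^{-1}\{f(\sigma^{j,j+1}\eta)-f(\eta)\},\qquad L_l=L_S+L_R+L_C+L_A,$$ $$(L_{0,1}f)(\eta)=f(\sigma^{0,1}\eta)-f(\eta),\qquad (L_{b,N}f)(\eta)=\sum_{k=1}^{N-2}\{f(\sigma^{k,k+1}\eta)-f(\eta)\},$$ $$(L_{r,N}f)(\eta)=\{\beta(1-\eta_{N-1})+(1-\beta)\eta_{N-1}\}\{f(\sigma^{N-1}\eta)-f(\eta)\}.$$ All of these are viewed as acting on functions on $\Omega_{N,p}$ in the obvious way ($L_l$ also acts on functions on $\Omega_p^*$). The chain with generator $L_N$ has a unique stationary state $\mu_N$; $E_{\mu_N}$ denotes expectation with respect to it. *)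

(* Defs.v *)
From HB Require Import structures.
From mathcomp Require Import all_boot all_order all_algebra perm.
From mathcomp Require Import all_classical all_reals all_analysis.

Set Implicit Arguments.
Unset Strict Implicit.
Unset Printing Implicit Defensive.

Import Order.TTheory GRing.Theory Num.Theory.
Import numFieldNormedType.Exports.

Local Open Scope classical_set_scope.
Local Open Scope ring_scope.

(* Lattices are shifted by p: the site k of {-p, ..., n - p} is the ordinal
   p + k of 'I_n.+1.  Thus {-p, ..., 0} is 'I_p.+1 (site 0 is the ordinal p),
   and for N >= 1 {-p, ..., N - 1} is 'I_(p + N.-1).+1. *)
Definition conf (n : nat) := {ffun 'I_n.+1 -> bool}.

Section Generators.
Variable R : realType.

Definition flip n (k : 'I_n.+1) (eta : conf n) : conf n :=
  [ffun i => if i == k then ~~ eta i else eta i].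

Definition exch n (j k : 'I_n.+1) (eta : conf n) : conf n :=
  [ffun i => eta (tperm j k i)].

Definition occ n (eta : conf n) (k : 'I_n.+1) : R := (eta k)%:R.

(* The left operators act on functions on conf n for every n >= p; then inord j
   is the site of 'I_n.+1 with the same value as j, as j <= p <= n.  The case
   n = p is the dynamics on {-p, ..., 0} alone. *)
Definition LR p n (r alpha : 'I_p.+1 -> R) (f : conf n -> R) (eta : conf n) : R :=
  \sum_(j < p.+1)
    r j * (alpha j * (1 - occ eta (inord j)) + occ eta (inord j) * (1 - alpha j))
    * (f (flip (inord j) eta) - f eta).

Definition LC p n (c : 'I_p.+1 -> 'I_p.+1 -> R) (f : conf n -> R) (eta : conf n) : R :=
  \sum_(j < p.+1) \sum_(k < p.+1)
    c j k * (occ eta (inord k) * (1 - occ eta (inord j))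
             + occ eta (inord j) * (1 - occ eta (inord k)))
    * (f (flip (inord j) eta) - f eta).

Definition LA p n (a : 'I_p.+1 -> 'I_p.+1 -> R) (f : conf n -> R) (eta : conf n) : R :=
  \sum_(j < p.+1) \sum_(k < p.+1)
    a j k * (occ eta (inord k) * occ eta (inord j)
             + (1 - occ eta (inord j)) * (1 - occ eta (inord k)))
    * (f (flip (inord j) eta) - f eta).

Definition LS (p : nat) n (f : conf n -> R) (eta : conf n) : R :=
  \sum_(0 <= j < p) (f (exch (inord j) (inord j.+1) eta) - f eta).

Definition Ll p n (r alpha : 'I_p.+1 -> R) (c a : 'I_p.+1 -> 'I_p.+1 -> R)
    (f : conf n -> R) (eta : conf n) : R :=
  LS p f eta + LR r alpha f eta + LC c f eta + LA a f eta.

Definition L01 (p : nat) n (f : conf n -> R) (eta : conf n) : R :=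
  f (exch (inord p) (inord p.+1) eta) - f eta.

Definition Lb (p N : nat) n (f : conf n -> R) (eta : conf n) : R :=
  \sum_(1 <= k < N.-1) (f (exch (inord (p + k)) (inord (p + k.+1)) eta) - f eta).

Definition Lr (p N : nat) n (beta : R) (f : conf n -> R) (eta : conf n) : R :=
  (beta * (1 - occ eta (inord (p + N.-1))) + (1 - beta) * occ eta (inord (p + N.-1)))
  * (f (flip (inord (p + N.-1)) eta) - f eta).

Definition LN p (N : nat) (beta : R) (r alpha : 'I_p.+1 -> R)
    (c a : 'I_p.+1 -> 'I_p.+1 -> R)
    (f : conf (p + N.-1) -> R) (eta : conf (p + N.-1)) : R :=
  Ll r alpha c a f eta + L01 p f eta + Lb p N f eta + Lr p N beta f eta.

Definition expect n (mu : {ffun conf n -> R}) (f : conf n -> R) : R :=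
  \sum_(eta : conf n) mu eta * f eta.

Definition is_prob n (mu : {ffun conf n -> R}) : Prop :=
  (forall eta, 0 <= mu eta) /\ \sum_(eta : conf n) mu eta = 1.

Definition stationary n (L : (conf n -> R) -> conf n -> R)
    (mu : {ffun conf n -> R}) : Prop :=
  is_prob mu /\ forall f : conf n -> R, expect mu (L f) = 0.

(* Classical solutions, continuous up to the boundary; the values of u outside
   [0, 1] are irrelevant. *)
Definition laplace_solution (u0 u1 : R) (u : R -> R) : Prop :=
  [/\ {within `[0, 1], continuous u},
      forall x : R, 0 < x < 1 ->
        [/\ derivable u x 1, derivable (derive1 u) x 1 & derive1 (derive1 u) x = 0],
      u 0 = u0
    & u 1 = u1].

Definition deviation p (N : nat) (G u : R -> R) (eta : conf (p + N.-1)) : R :=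
  `| N%:R^-1 * \sum_(1 <= k < N)
       G (k%:R / N%:R) * (occ eta (inord (p + k)) - u (k%:R / N%:R)) |.

End Generators.

(* Main.v *)
Require Import Defs.
From HB Require Import structures.
From mathcomp Require Import all_boot all_order all_algebra perm.
From mathcomp Require Import all_classical all_reals all_analysis.
From mathcomp Require Import ring lra zify.

(** Both dynamics are symmetric exclusion on a path of sites together with
    spin flips, and the flip rate w_i at site i is such that w_i (1 - 2 eta_i),
    the drift of eta_i, is affine in eta: a reservoir contributes
    r (alpha - eta_i), a copying interaction c (eta_k - eta_i) and an
    anti-copying one a (1 - eta_k - eta_i).  Consequently the stationary means
    and the stationary covariances solve closed linear systems ([mean_eq],
    [cov_eq]), and no entropy or coupling argument is needed.

    Uniqueness of the stationary states.  A function killed by the generator is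
    constant: the set of its maximum points is stable under exchanges and under
    flips of positive rate, and from every configuration these lead to one and
    the same constant configuration; the same holds for minimum points.  For a
    finite chain this yields existence and uniqueness
    ([finite_chain_unique_stationary]).

    Means.  In the bulk the mean is discrete harmonic, hence affine with slope
    (beta - rho_N(0)) / N.  Near the left boundary it solves the equation of the
    small system up to a source term at site 0 equal to this slope, which is
    O(1/N).  The linear operator of the small system is a Laplacian plus a
    matrix dominated by a killed Markov matrix, so it is invertible by the
    maximum principle, and the mean is within O(1/N) of the affine profile
    ([profile_near_linear]).

    Covariances.  Let psi(i,j) be the absolute covariance.  Multiplying the
    covariance equation by its sign and by m_i m_j, for a nonnegative weight m,
    and summing by parts over pairs of distinct sites moves the operator to the
    weight; exclusion only helps, since an exchange of the two sites of a pair
    contributes - (m_i - m_j)^2.  The result ([weighted_cov_bound]) bounds the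
    sum of psi(i,j) m_j (- K^T m)_i, with K the one-particle operator, by a
    contribution of the pairs of boundary sites plus the sum of
    m_k m_(k+1) (rho_k - rho_(k+1))^2.  One weight is enough: on the boundary
    sites m is a row of the Green function of the small system, so that K^T m
    balances there the flux from the bulk, and in the bulk it is the concave
    function k - k^2 / (2N), up to a constant, so that - K^T m >= 1/N.  As
    m_k >= k/2 and the squared gradients are O(1/N^2), the sum of psi(i,j) j over
    bulk pairs is O(N^2) ([bulk_cov_bound]).  Splitting the pairs according to
    j < K or j >= K shows that the variance of the empirical average is at most a
    constant times K/N + 1/K ([second_moment_bound]), and it remains to let N,
    then K, tend to infinity. *)

Set Implicit Arguments.
Unset Strict Implicit.
Unset Printing Implicit Defensive.

Import Order.TTheory GRing.Theory Num.Theory.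
Import numFieldNormedType.Exports.

Local Open Scope classical_set_scope.
Local Open Scope ring_scope.

(** * Stationary states of finite Markov chains *)

(** A square matrix and its transpose have the same determinant; this is the
    form of that fact needed for matrices indexed by an arbitrary finite type. *)
Lemma left_null_of_right_null (F : fieldType) (S : finType) (Q : S -> S -> F)
    (f : S -> F) (x0 : S) :
  f x0 != 0 -> (forall x, \sum_y Q x y * f y = 0) ->
  exists nu : S -> F,
    (exists x, nu x != 0) /\ forall y, \sum_x nu x * Q x y = 0.
Proof.
move=> fx0 Qf.
pose M := \matrix_(i < #|S|, j < #|S|) Q (enum_val i) (enum_val j).
have : \det M == 0.
  rewrite -det_tr; apply/det0P; exists (\row_j f (enum_val j)).
    apply/eqP => /rowP /(_ (enum_rank x0)); rewrite !mxE enum_rankK.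
    exact/eqP.
  apply/rowP => i; rewrite !mxE -[RHS](Qf (enum_val i)).
  rewrite [RHS](reindex (@enum_val S predT)); last exact/onW_bij/enum_val_bij.
  by apply: eq_bigr => j _; rewrite !mxE mulrC.
move/det0P => [u u0 uM].
exists (fun x => u 0 (enum_rank x)); split.
  have /rV0Pn[i ui] := u0.
  by exists (enum_val i); rewrite enum_valK.
move=> y; have /rowP/(_ (enum_rank y)) := uM; rewrite !mxE => uMy.
rewrite -[RHS]uMy [LHS](reindex (@enum_val S predT)); last exact/onW_bij/enum_val_bij.
by apply: eq_bigr => j _; rewrite !mxE enum_valK enum_rankK.
Qed.

Section FiniteChain.
Variables (R : realFieldType) (S : finType) (q : S -> S -> R).
Hypothesis q_ge0 : forall x y, 0 <= q x y.

Let Q x y := q x y - (x == y)%:R * \sum_z q x z.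

Let sum_Q (h : S -> R) x : \sum_y Q x y * h y = \sum_y q x y * (h y - h x).
Proof.
under eq_bigr do rewrite mulrBl.
under [RHS]eq_bigr do rewrite mulrBr.
rewrite !big_split /= !sumrN; congr (_ - _).
rewrite (bigD1 x) //= eqxx mul1r [X in _ + X]big1 ?addr0 ?mulr_suml //.
by move=> y yx; rewrite eq_sym (negPf yx) !mul0r.
Qed.

Let pairing (nu h : S -> R) :
  \sum_x nu x * (\sum_y q x y * (h y - h x)) = \sum_y (\sum_x nu x * Q x y) * h y.
Proof.
under eq_bigr do rewrite -sum_Q mulr_sumr.
rewrite exchange_big /=; apply: eq_bigr => y _; rewrite mulr_suml.
by apply: eq_bigr => x _; rewrite mulrA.
Qed.

(** Row sums of Q vanish and its off-diagonal entries are nonnegative, so |nu| Q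
    has nonnegative entries of total mass zero. *)
Let normr_null (nu : S -> R) :
  (forall y, \sum_x nu x * Q x y = 0) -> forall y, \sum_x `|nu x| * Q x y = 0.
Proof.
move=> nuQ.
have balance (g : S -> R) y :
    \sum_x g x * Q x y = \sum_x g x * q x y - g y * \sum_z q y z.
  under eq_bigr do rewrite mulrBr.
  rewrite big_split /= sumrN; congr (_ - _).
  rewrite (bigD1 y) //= eqxx mul1r [X in _ + X]big1 ?addr0 //.
  by move=> x xy; rewrite (negPf xy) mul0r mulr0.
have ge0 y : 0 <= \sum_x `|nu x| * Q x y.
  have /eqP := nuQ y; rewrite !balance !subr_eq0 subr_ge0 => /eqP nuy.
  have out_ge0 : 0 <= \sum_z q y z by apply: sumr_ge0.
  rewrite -[leLHS](ger0_norm (mulr_ge0 (normr_ge0 _) out_ge0)) normrM normr_id.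
  rewrite -normrM -nuy; apply: le_trans (ler_norm_sum _ _ _) _.
  by apply: ler_sum => x _; rewrite normrM (ger0_norm (q_ge0 _ _)).
have sum0 : \sum_y \sum_x `|nu x| * Q x y = 0.
  transitivity (\sum_y (\sum_x `|nu x| * Q x y) * 1).
    by under [RHS]eq_bigr do rewrite mulr1.
  rewrite -(pairing (fun x => `|nu x|) (fun=> 1)).
  by rewrite big1 // => x _; rewrite big1 ?mulr0 // => y _; rewrite subrr mulr0.
move=> y; apply/eqP; move: sum0 => /eqP; rewrite psumr_eq0 //.
by move/allP/(_ y); rewrite mem_index_enum; apply.
Qed.

(** Constants are in the right kernel of Q, so its left kernel contains some
    nu <> 0, and |nu| normalised is a stationary state. *)
Lemma finite_chain_unique_stationary (x0 : S) :
  (forall h : S -> R, (forall x, \sum_y q x y * (h y - h x) = 0) ->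
     forall x, h x = h x0) ->
  exists! mu : {ffun S -> R},
    ((forall x, 0 <= mu x) /\ \sum_x mu x = 1) /\
    forall h : S -> R, \sum_x mu x * (\sum_y q x y * (h y - h x)) = 0.
Proof.
move=> ker_const.
have [nu [[x1 nux1] nuQ]] : exists nu : S -> R,
    (exists x, nu x != 0) /\ forall y, \sum_x nu x * Q x y = 0.
  apply: (@left_null_of_right_null _ _ _ (fun=> 1) x0); first exact: oner_neq0.
  by move=> x; rewrite sum_Q big1 // => y _; rewrite subrr mulr0.
have mass_gt0 : 0 < \sum_x `|nu x|.
  rewrite (bigD1 x1) //= ltr_pwDl ?normr_gt0 //.
  by apply: sumr_ge0 => x _.
pose mu := [ffun x => `|nu x| / \sum_x `|nu x|].
have muQ y : \sum_x mu x * Q x y = 0.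
  transitivity ((\sum_x `|nu x|)^-1 * \sum_x `|nu x| * Q x y).
    rewrite mulr_sumr; apply: eq_bigr => x _.
    by rewrite ffunE -mulrA mulrCA.
  by rewrite normr_null // mulr0.
have mu1 : \sum_x mu x = 1.
  under eq_bigr do rewrite ffunE.
  by rewrite -mulr_suml divff ?gt_eqF.
exists mu; split.
  split; first by split=> // x; rewrite ffunE divr_ge0 // ltW.
  by move=> h; rewrite pairing big1 // => y _; rewrite muQ mul0r.
move=> mu' [[_ mu'1] mu'L].
have mu'Q y : \sum_x mu' x * Q x y = 0.
  have := mu'L (fun z => (z == y)%:R); rewrite pairing (bigD1 y) //= eqxx mulr1.
  by rewrite [X in _ + X]big1 ?addr0 // => z zy; rewrite (negPf zy) mulr0.
apply/ffunP => x; apply/eqP; rewrite eq_sym -subr_eq0; apply/negPn/negP => dx.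
(* Let Q' be the transpose of Q plus the rank-one matrix with all columns equal
   to mu.  If mu' <> mu then mu' - mu is in the right kernel of Q', while its left
   kernel is trivial: pairing with mu reduces h Q' = 0 to Q h = 0 and mu h = 0. *)
pose Q' y z := Q z y + mu y.
have [y|h [[z hz] hQ]] :=
    @left_null_of_right_null _ _ Q' (fun x => mu' x - mu x) x dx.
  under eq_bigr do rewrite mulrDl.
  rewrite big_split /= -mulr_sumr sumrB mu'1 mu1 subrr mulr0 addr0.
  under eq_bigr do rewrite mulrC mulrBl.
  by rewrite sumrB mu'Q muQ subrr.
have hL y : \sum_z Q y z * h z + \sum_z mu z * h z = 0.
  rewrite -[RHS](hQ y) -big_split; apply: eq_bigr => w _ /=.
  by rewrite /Q' mulrDr !(mulrC (h _)).
have mu_h : \sum_z mu z * h z = 0.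
  have : \sum_y mu y * (\sum_z Q y z * h z + \sum_z mu z * h z) = 0.
    by rewrite big1 // => y _; rewrite hL mulr0.
  under eq_bigr do rewrite mulrDr.
  rewrite big_split /= -mulr_suml mu1 mul1r.
  under eq_bigr do rewrite sum_Q.
  by rewrite pairing big1 ?add0r // => y _; rewrite muQ mul0r.
have h_cst : forall y, h y = h x0.
  by apply: ker_const => y; have := hL y; rewrite mu_h addr0 sum_Q.
move: mu_h; under eq_bigr do rewrite h_cst.
rewrite -mulr_suml mu1 mul1r -(h_cst z) => hz0.
by rewrite hz0 eqxx in hz.
Qed.
End FiniteChain.

(** * Exclusion with flips on a path *)

Section Path.
Variables (R : realType) (n : nat).

Definition bond (k : nat) : {perm 'I_n.+1} := tperm (inord k) (inord k.+1).

Definition lap (h : 'I_n.+1 -> R) (i : 'I_n.+1) : R :=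
  \sum_(0 <= k < n) (h (bond k i) - h i).

Lemma bondK k : involutive (bond k).
Proof. exact: tpermK. Qed.

(** The Laplacian defined by the exchanges of the path is the usual one, with
    reflection at both ends. *)
Lemma lapE (h : nat -> R) (i : 'I_n.+1) :
  lap h i = (if (0 < i)%N then h i.-1 - h i else 0)
          + (if (i < n)%N then h i.+1 - h i else 0).
Proof.
have term k : (0 <= k < n)%N -> h (bond k i) - h i =
    (if (k == i.-1) && (0 < i)%N then h i.-1 - h i else 0)
    + (if k == i then h i.+1 - h i else 0).
  move=> /andP[_ kn].
  have kE : (inord k : 'I_n.+1) = k :> nat by rewrite inordK // ltnS ltnW.
  have kSE : (inord k.+1 : 'I_n.+1) = k.+1 :> nat by rewrite inordK.
  have -> : (k == i.-1) && (0 < i)%N = (i == inord k.+1).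
    rewrite -val_eqE /= kSE; case: (i : nat) => [|j] /=; rewrite ?andbF //.
    by rewrite andbT eqSS eq_sym.
  have -> : (k == i) = (i == inord k) by rewrite -val_eqE /= kE eq_sym.
  rewrite /bond; case: tpermP => [->|->|/eqP/negPf-> /eqP/negPf->].
  - by rewrite -!val_eqE /= kE kSE eqxx eqn_leq ltnn andbF add0r.
  - by rewrite -!val_eqE /= kE kSE eqxx eqn_leq ltnn /= addr0.
  - by rewrite subrr addr0.
rewrite /lap (eq_big_nat _ _ term) big_split /= -!big_mkcond /=.
rewrite big_nat1_eq /=; congr (_ + _).
rewrite (eq_bigl (fun k => (0 < i)%N && (k == i.-1))); last by move=> k; rewrite andbC.
case: posnP => [->|i0] /=; first by rewrite big_pred0.
by rewrite big_nat1_eq /= prednK // -ltnS ltn_ord.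
Qed.

Lemma path_connected (P : nat -> Prop) (i0 : nat) :
  (i0 <= n)%N -> P i0 ->
  (forall i, (i < n)%N -> P i <-> P i.+1) -> forall i, (i <= n)%N -> P i.
Proof.
move=> i0n Pi0 step.
have P0 : P 0%N.
  by elim: i0 i0n Pi0 => // i IH lt_in /(step _ lt_in); apply: IH; exact: ltnW.
by elim=> // i IH lt_in; apply/(step _ lt_in)/IH/ltnW.
Qed.

(** The common form of the two generators: only the length of the path and the
    rates w differ between the small system and the systems of size N. *)
Definition flip_exclusion (w : 'I_n.+1 -> conf n -> R) (f : conf n -> R)
    (eta : conf n) : R :=
  \sum_(0 <= k < n) (f (exch (inord k) (inord k.+1) eta) - f eta)
  + \sum_i w i eta * (f (flip i eta) - f eta).

Definition set_site (i : 'I_n.+1) (b : bool) (eta : conf n) : conf n :=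
  [ffun j => if j == i then b else eta j].

(** Conjugating the operation of setting site i by the exchange of i and i + 1
    gives the one at i + 1.  So if it is allowed at one site then, with exchanges,
    it is allowed everywhere. *)
Let set_site_all (P : conf n -> Prop) (i0 : 'I_n.+1) (b : bool) :
  (forall eta, P eta -> P (set_site i0 b eta)) ->
  (forall k eta, (k < n)%N -> P eta -> P (exch (inord k) (inord k.+1) eta)) ->
  forall eta, P eta -> P [ffun=> b].
Proof.
move=> set0 swap.
have conj i j eta : set_site i b (exch i j (eta : conf n))
    = exch i j (set_site j b eta).
  apply/ffunP => l; rewrite !ffunE; case: tpermP => [->|->|/eqP/negPf li /eqP/negPf lj].
  - by rewrite !eqxx.
  - by rewrite (eq_sym j).
  - by rewrite li lj.
have exchC i j eta : exch i j (eta : conf n) = exch j i eta.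
  by apply/ffunP => l; rewrite !ffunE tpermC.
have exchK i j : involutive (@exch n i j).
  by move=> eta; apply/ffunP => l; rewrite !ffunE tpermK.
have setP i : (i <= n)%N -> forall eta, P eta -> P (set_site (inord i) b eta).
  move: i; apply: (@path_connected _ i0); [by rewrite -ltnS|by rewrite inord_val|].
  move=> i lt_in; split=> IH eta /(swap _ _ lt_in)/IH/(swap _ _ lt_in).
  - by rewrite conj exchK.
  - by rewrite [exch _ _ eta]exchC conj exchC exchK.
move=> eta Peta.
suff: P (foldr (fun i => set_site i b) eta (enum 'I_n.+1)).
  congr P; apply/ffunP => j; rewrite ffunE.
  have: j \in enum 'I_n.+1 by rewrite mem_enum.
  elim: (enum 'I_n.+1) => //= i s IH; rewrite inE ffunE.
  by case: eqP => // _ /= /IH.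
elim: (enum 'I_n.+1) => //= i s IH.
by rewrite -(inord_val i); apply: setP => //; rewrite -ltnS.
Qed.

Variable w : 'I_n.+1 -> conf n -> R.
Hypothesis w_ge0 : forall i eta, 0 <= w i eta.

(** Maximum principle: at a maximum point of f every term of the generator is
    nonpositive, hence zero, so exchanges and flips of positive rate do not leave
    the set of maximum points. *)
Let flip_exclusion_ker_le (i0 : 'I_n.+1) (b : bool)
    (w_gt0 : forall eta : conf n, eta i0 != b -> 0 < w i0 eta) f :
  (forall eta, flip_exclusion w f eta = 0) -> forall eta, f eta <= f [ffun=> b].
Proof.
move=> Lf.
pose top := [arg max_(eta > [ffun=> b] : conf n) f eta]%O.
have f_le eta : f eta <= f top.
  by rewrite /top; case: arg_maxP => // z _ /(_ eta isT).
have sat eta : f eta = f top ->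
    (forall k, (k < n)%N -> f (exch (inord k) (inord k.+1) eta) = f top) /\
    (forall i, w i eta * (f (flip i eta) - f top) = 0).
  move=> feta; have := Lf eta; rewrite /flip_exclusion feta => /eqP.
  have le_swap k : 0 <= f top - f (exch (inord k) (inord k.+1) eta).
    by rewrite subr_ge0.
  have le_flip i : 0 <= w i eta * (f top - f (flip i eta)).
    by rewrite mulr_ge0 // subr_ge0.
  rewrite -oppr_eq0 opprD -!sumrN paddr_eq0; last 2 first.
  - by apply: sumr_ge0 => k _; rewrite opprB.
  - by apply: sumr_ge0 => k _; rewrite -mulrN opprB.
  rewrite big_mkord !psumr_eq0 => [|i _|k _]; last 2 first.
  - by rewrite -mulrN opprB.
  - by rewrite opprB.
  move=> /andP[/allP swap0 /allP flip0]; split=> [k lt_kn|i].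
    have /= := swap0 (Ordinal lt_kn); rewrite mem_index_enum => /(_ isT).
    by rewrite oppr_eq0 subr_eq0 => /eqP.
  have := flip0 i; rewrite mem_index_enum => /(_ isT) /=.
  by rewrite oppr_eq0 => /eqP.
suff -> : f [ffun=> b] = f top by [].
apply: (@set_site_all (fun eta => f eta = f top) i0 b _ _ top) => //.
- move=> eta feta; have [eq_b|neq_b] := eqVneq (eta i0) b.
    suff -> : set_site i0 b eta = eta by [].
    by apply/ffunP => j; rewrite ffunE; case: eqP => // ->.
  have -> : set_site i0 b eta = flip i0 eta.
    apply/ffunP => j; rewrite !ffunE; case: eqP => // ->.
    by move: neq_b; case: (eta i0); case: (b).
  have /eqP := (sat _ feta).2 i0.
  by rewrite mulf_eq0 gt_eqF ?w_gt0 //= subr_eq0 => /eqP.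
- by move=> k eta lt_kn feta; apply: (sat _ feta).1.
Qed.

(** If some site can always be flipped towards the value b, the constant
    configuration b is reached from everywhere. *)
Lemma flip_exclusion_unique_stationary (i0 : 'I_n.+1) (b : bool) :
  (forall eta : conf n, eta i0 != b -> 0 < w i0 eta) ->
  exists! mu : {ffun conf n -> R}, stationary (flip_exclusion w) mu.
Proof.
move=> w_gt0.
pose q (x y : conf n) : R :=
  \sum_(0 <= k < n) (y == exch (inord k) (inord k.+1) x)%:R
  + \sum_i w i x * (y == flip i x)%:R.
have q_ge0 x y : 0 <= q x y.
  by rewrite addr_ge0 // sumr_ge0 // => i _; rewrite mulr_ge0.
have pick (z : conf n) (g : conf n -> R) : \sum_y (y == z)%:R * g y = g z.
  rewrite (bigD1 z) //= eqxx mul1r big1 ?addr0 // => y yz.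
  by rewrite (negPf yz) mul0r.
have q_flip_exclusion f x : \sum_y q x y * (f y - f x) = flip_exclusion w f x.
  under eq_bigr do rewrite /q mulrDl !mulr_suml.
  rewrite big_split /= /flip_exclusion; congr (_ + _); rewrite exchange_big /=.
    by apply: eq_bigr => k _; rewrite (pick _ (fun y => f y - f x)).
  apply: eq_bigr => i _; under eq_bigr do rewrite -mulrA.
  by rewrite -mulr_sumr (pick _ (fun y => f y - f x)).
have flip_exclusionN f x : flip_exclusion w (fun eta => - f eta) x = - flip_exclusion w f x.
  rewrite /flip_exclusion opprD -!sumrN; congr (_ + _); apply: eq_bigr => i _.
    by rewrite /= opprD.
  by rewrite /= -opprD mulrN.
have [h ker|mu [[mu_prob muL] mu_uniq]] :=
    @finite_chain_unique_stationary _ _ q q_ge0 [ffun=> b].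
  have Lh x : flip_exclusion w h x = 0 by rewrite -q_flip_exclusion.
  move=> x; apply/eqP; rewrite eq_le (flip_exclusion_ker_le w_gt0 Lh) -lerN2 /=.
  apply: (@flip_exclusion_ker_le i0 b w_gt0 (fun eta => - h eta)) => y.
  by rewrite flip_exclusionN Lh oppr0.
exists mu; split.
  by split=> // f; rewrite /expect -[RHS](muL f); apply: eq_bigr => x _; rewrite q_flip_exclusion.
move=> mu' [mu'_prob mu'L]; apply: mu_uniq; split=> // f.
by rewrite -[RHS](mu'L f); apply: eq_bigr => x _; rewrite q_flip_exclusion.
Qed.
End Path.

(** * Stationary means and covariances *)

Lemma sg_mul_le_norm (R : realDomainType) (x y : R) : Num.sg x * y <= `|y|.
Proof.
apply: le_trans (ler_norm _) _; rewrite normrM normr_sg.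
by case: (_ != 0); rewrite ?mul1r ?mul0r.
Qed.

Lemma occ_itv (R : realType) n (eta : conf n) i : 0 <= occ R eta i <= 1.
Proof. by rewrite /occ; case: (eta i); rewrite /= ?lexx ?ler01. Qed.

Lemma occ_sqr (R : realType) n (eta : conf n) i : occ R eta i * occ R eta i = occ R eta i.
Proof. by rewrite /occ; case: (eta i); rewrite ?mulr0 ?mulr1. Qed.

Section Expectation.
Variables (R : realType) (n : nat) (mu : {ffun conf n -> R}).

Lemma expectD f g : expect mu (fun x => f x + g x) = expect mu f + expect mu g.
Proof. by rewrite -big_split; apply: eq_bigr => x _; rewrite mulrDr. Qed.

Lemma expectZ a f : expect mu (fun x => a * f x) = a * expect mu f.
Proof. by rewrite /expect mulr_sumr; apply: eq_bigr => x _; rewrite mulrCA. Qed.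

Lemma expectB f g : expect mu (fun x => f x - g x) = expect mu f - expect mu g.
Proof. by rewrite -sumrB; apply: eq_bigr => x _; rewrite mulrBr. Qed.

Lemma expect_sum (I : Type) (s : seq I) (P : pred I) (F : I -> conf n -> R) :
  expect mu (fun x => \sum_(i <- s | P i) F i x)
  = \sum_(i <- s | P i) expect mu (F i).
Proof. by rewrite /expect exchange_big; apply: eq_bigr => x _; rewrite mulr_sumr. Qed.

Lemma eq_expect f g : f =1 g -> expect mu f = expect mu g.
Proof. by move=> fg; apply: eq_bigr => x _; rewrite fg. Qed.

Hypothesis mu_prob : is_prob mu.

Lemma expect_cst a : expect mu (fun=> a) = a.
Proof. by rewrite /expect -mulr_suml mu_prob.2 mul1r. Qed.

Lemma le_expect f g : (forall x, f x <= g x) -> expect mu f <= expect mu g.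
Proof.
by move=> fg; apply: ler_sum => x _; apply: ler_wpM2l (fg x); apply: mu_prob.1.
Qed.

Lemma expect_ge0 f : (forall x, 0 <= f x) -> 0 <= expect mu f.
Proof. by move=> f0; rewrite -(expect_cst 0); apply: le_expect. Qed.

Lemma normr_expect_le f : `|expect mu f| <= expect mu (fun x => `|f x|).
Proof.
apply: le_trans (ler_norm_sum _ _ _) _; apply: ler_sum => x _.
by rewrite normrM ger0_norm // mu_prob.1.
Qed.

Definition mean i := expect mu (fun eta => occ R eta i).

Definition dev (i : 'I_n.+1) (eta : conf n) := occ R eta i - mean i.

Definition cov i j := expect mu (fun eta => dev i eta * dev j eta).

Lemma mean_itv i : 0 <= mean i <= 1.
Proof.
rewrite expect_ge0 => [|x]; last by case/andP: (occ_itv R x i).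
by rewrite -(expect_cst 1) le_expect // => x; case/andP: (occ_itv R x i).
Qed.

Lemma normr_cov_le1 i j : `|cov i j| <= 1.
Proof.
apply: le_trans (normr_expect_le _) _; rewrite -[leRHS]expect_cst.
apply: le_expect => x; rewrite normrM.
have dev1 k : `|dev k x| <= 1.
  have /andP[? ?] := mean_itv k; have /andP[? ?] := occ_itv R x k.
  by rewrite ler_norml /dev; apply/andP; split; lra.
by rewrite -[leRHS]mulr1 ler_pM.
Qed.

Lemma expect_dev i : expect mu (dev i) = 0.
Proof. by rewrite /dev expectB expect_cst subrr. Qed.

Lemma covC i j : cov i j = cov j i.
Proof. by apply: eq_expect => x; rewrite mulrC. Qed.

Lemma expect_mul_dev f i (g : 'I_n.+1 -> R) a :
  (forall eta, f eta = a + \sum_k g k * occ R eta k) ->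
  expect mu (fun eta => f eta * dev i eta) = \sum_k g k * cov k i.
Proof.
move=> fE.
transitivity (expect mu (fun eta => (a + \sum_k g k * mean k) * dev i eta
                                    + \sum_k g k * (dev k eta * dev i eta))).
  apply: eq_expect => x; rewrite fE.
  under [X in _ = _ + X]eq_bigr do rewrite mulrA.
  rewrite -mulr_suml -mulrDl -addrA -big_split /=; congr ((_ + _) * _).
  by apply: eq_bigr => k _; rewrite -mulrDr /dev addrC subrK.
rewrite expectD expectZ expect_dev mulr0 add0r expect_sum.
by apply: eq_bigr => k _; rewrite expectZ.
Qed.
End Expectation.

Section Moments.
Variables (R : realType) (n : nat) (w : 'I_n.+1 -> conf n -> R).
Variables (b : 'I_n.+1 -> R) (B : 'I_n.+1 -> 'I_n.+1 -> R).
Hypothesis drift : forall i eta,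
  w i eta * (1 - 2 * occ R eta i) = b i + \sum_k B i k * occ R eta k.
Variable mu : {ffun conf n -> R}.
Hypothesis mu_stat : stationary (flip_exclusion w) mu.

Let mu_prob : is_prob mu := mu_stat.1.
Local Notation mean := (mean mu).
Local Notation dev := (dev mu).
Local Notation cov := (cov mu).

Let occ_exch k (eta : conf n) i :
  occ R (exch (inord k) (inord k.+1) eta) i = occ R eta (bond n k i).
Proof. by rewrite /occ ffunE. Qed.

Let occ_flip k (eta : conf n) i :
  occ R (flip k eta) i = occ R eta i + (i == k)%:R * (1 - 2 * occ R eta i).
Proof.
rewrite /occ ffunE; case: (i == k); rewrite ?mul0r ?addr0 // mul1r.
by case: (eta i) => /=; lra.
Qed.

Lemma mean_eq i : lap mean i + b i + \sum_k B i k * mean k = 0.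
Proof.
rewrite -[RHS](mu_stat.2 (fun eta => occ R eta i)) /flip_exclusion.
rewrite expectD expect_sum /lap -addrA.
congr (_ + _).
  by apply: eq_bigr => k _; rewrite -expectB; apply: eq_expect => x; rewrite occ_exch.
rewrite -[b i](expect_cst mu_prob).
under eq_bigr do rewrite -expectZ.
rewrite -expect_sum -expectD; apply: eq_expect => x; rewrite -drift.
rewrite (bigD1 i) //= big1 ?addr0 => [|k ki].
  by rewrite occ_flip eqxx mul1r; ring.
by rewrite occ_flip eq_sym (negPf ki) mul0r addr0 subrr mulr0.
Qed.

(** Centering at the stationary means leaves, for each exchange, the product of
    the increments of the mean as a source term; it vanishes unless the exchange
    swaps i and j.  The sums over k run over all sites: the terms k = j and k = i
    are variances, which act as boundary data for the system of covariances of
    distinct sites. *)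
Lemma cov_eq i j : i != j ->
  \sum_(0 <= k < n) (cov (bond n k i) (bond n k j) - cov i j
     + (mean (bond n k i) - mean i) * (mean (bond n k j) - mean j))
  + (\sum_k B i k * cov k j + \sum_k B j k * cov k i) = 0.
Proof.
move=> ij; rewrite -[RHS](mu_stat.2 (fun eta => dev i eta * dev j eta)) /flip_exclusion.
rewrite expectD expect_sum; congr (_ + _).
  apply: eq_bigr => k _.
  transitivity (expect mu (fun x =>
     dev (bond n k i) x * dev (bond n k j) x - dev i x * dev j x
     + ((mean (bond n k j) - mean j) * dev (bond n k i) x
     + ((mean (bond n k i) - mean i) * dev (bond n k j) x
     + (mean (bond n k i) - mean i) * (mean (bond n k j) - mean j))))).
    rewrite expectD expectB !expectD !expectZ !expect_dev // expect_cst //.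
    by rewrite !mulr0 !add0r.
  by apply: eq_expect => x; rewrite /dev !occ_exch; ring.
rewrite -(expect_mul_dev mu_prob j (drift i)) -(expect_mul_dev mu_prob i (drift j)).
rewrite -expectD; apply: eq_expect => x.
rewrite (bigD1 i) //= (bigD1 j) 1?eq_sym //= big1 ?addr0 => [|k /andP[ki kj]].
  rewrite /dev !occ_flip !eqxx (eq_sym j i) (negPf ij) !mul1r !mul0r; ring.
by rewrite /dev !occ_flip !(eq_sym _ k) (negPf ki) (negPf kj) !mul0r !addr0 subrr mulr0.
Qed.

(* H forgets the signs of the off-diagonal entries of B: absolute covariances
   satisfy the covariance equation with B replaced by H, as an inequality. *)
Variable H : 'I_n.+1 -> 'I_n.+1 -> R.
Hypothesis B_le : forall i k, i != k -> `|B i k| <= H i k.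
Hypothesis B_diag : forall i, B i i <= H i i.
Variable m : 'I_n.+1 -> R.
Hypothesis m_ge0 : forall i, 0 <= m i.

Let H_ge0 i k : i != k -> 0 <= H i k.
Proof. by move/B_le; apply: le_trans. Qed.

Let psi i j := `|cov i j|.

Let psiC i j : psi i j = psi j i.
Proof. by rewrite /psi covC. Qed.

Let abs_cov_ineq i j : i != j ->
  0 <= \sum_(0 <= k < n) (psi (bond n k i) (bond n k j) - psi i j
         + `|(mean (bond n k i) - mean i) * (mean (bond n k j) - mean j)|)
       + (\sum_k H i k * psi k j + \sum_k H j k * psi k i).
Proof.
move=> ij; pose s : R := Num.sg (cov i j).
have s_le := sg_mul_le_norm (cov i j); rewrite -/s in s_le.
have sB a c k : cov a k = cov i j -> s * (B a c * cov c k) <= H a c * psi c k.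
  move=> cov_ak; have [ac|ac] := eqVneq a c.
    rewrite -ac cov_ak mulrCA /s -normrEsg /psi cov_ak.
    by apply: ler_wpM2r (B_diag a).
  apply: le_trans (s_le _) _; rewrite normrM; exact: ler_wpM2r (B_le ac).
rewrite -[leLHS](mulr0 s) -[X in s * X](cov_eq ij) !mulrDr !mulr_sumr lerD //.
  apply: ler_sum => k _; rewrite mulrDr lerD ?s_le //.
  by rewrite mulrBr lerB ?s_le // /s -normrEsg.
by rewrite lerD //; apply: ler_sum => k _; apply: sB => //; rewrite covC.
Qed.

Lemma sum_offdiag_swap (F : 'I_n.+1 -> 'I_n.+1 -> R) :
  \sum_i \sum_(j | j != i) F i j = \sum_i \sum_(j | j != i) F j i.
Proof.
rewrite (exchange_big_dep predT) //=; apply: eq_bigr => i _.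
by apply: eq_bigl => j; rewrite eq_sym.
Qed.

Lemma sum_offdiag_perm (s : {perm 'I_n.+1}) (F : 'I_n.+1 -> 'I_n.+1 -> R) :
  \sum_i \sum_(j | j != i) F (s i) (s j) = \sum_i \sum_(j | j != i) F i j.
Proof.
rewrite [RHS](reindex_inj (@perm_inj _ s)); apply: eq_bigr => i _.
rewrite [RHS](reindex_inj (@perm_inj _ s)); apply: eq_bigl => j.
by rewrite (inj_eq perm_inj).
Qed.

(** Summation by parts for one exchange: the two-particle dynamics is symmetric,
    so the exchange can be moved to the weight m_i m_j, and the defect between
    exclusion and independent particles has a sign. *)
Let exclusion_part k : (k < n)%N ->
  \sum_i \sum_(j | j != i) m i * m j *
     (psi (bond n k i) (bond n k j) - psi i j
      + `|(mean (bond n k i) - mean i) * (mean (bond n k j) - mean j)|)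
  <= 2 * (\sum_i \sum_(j | j != i) psi i j * m j * (m (bond n k i) - m i))
     + 2 * (m (inord k) * m (inord k.+1)
            * (mean (inord k) - mean (inord k.+1)) ^+ 2).
Proof.
move=> lt_kn; set t := bond n k.
have ab : (inord k : 'I_n.+1) != inord k.+1.
  by rewrite -val_eqE /= !inordK ?ltnS ?(ltnW lt_kn) // eqn_leq ltnn andbF.
have tD c : c != inord k -> c != inord k.+1 -> t c = c.
  by move=> ca cb; rewrite /t /bond tpermD // eq_sym.
have tL : t (inord k) = inord k.+1 by rewrite /t /bond tpermL.
have tR : t (inord k.+1) = inord k by rewrite /t /bond tpermR.
under eq_bigr do (under eq_bigr do rewrite mulrDr; rewrite big_split /=).
rewrite big_split /= lerD //.
  under eq_bigr do (under eq_bigr do rewrite mulrBr; rewrite sumrB).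
  rewrite sumrB -(sum_offdiag_perm t) /=.
  under eq_bigr do under eq_bigr do rewrite /t !bondK -/t.
  have -> : 2 * (\sum_i \sum_(j | j != i) psi i j * m j * (m (t i) - m i)) =
     \sum_i \sum_(j | j != i) (psi i j * m j * (m (t i) - m i)
                               + psi i j * m i * (m (t j) - m j)).
    under [RHS]eq_bigr do rewrite big_split.
    rewrite big_split /= mulrDl mul1r; congr (_ + _).
    rewrite sum_offdiag_swap; apply: eq_bigr => i _; apply: eq_bigr => j _.
    by rewrite psiC.
  rewrite -sumrB; apply: ler_sum => i _; rewrite -sumrB; apply: ler_sum => j ji.
  (* nonzero only when t swaps i and j, and then minus a square *)
  have neg : (m (t i) - m i) * (m (t j) - m j) <= 0.
    have neg0 x y : (x - y) * (y - x) <= 0 :> R.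
      by rewrite -(opprB x y) mulrN oppr_le0 -expr2 sqr_ge0.
    rewrite /t /bond; case: tpermP => [iE|iE|_ _]; last by rewrite subrr mul0r.
      case: tpermP => [jE|jE|_ _]; last by rewrite subrr mulr0.
        by rewrite iE jE eqxx in ji.
      by rewrite iE jE neg0.
    case: tpermP => [jE|jE|_ _]; last by rewrite subrr mulr0.
      by rewrite iE jE neg0.
    by rewrite iE jE eqxx in ji.
  have := mulr_ge0_le0 (normr_ge0 (cov i j)) neg.
  rewrite -/(psi i j) -subr_ge0 => ge0; rewrite -subr_ge0.
  by apply: le_trans ge0 _; rewrite le_eqVlt; apply/orP; left; apply/eqP; ring.
rewrite (bigD1 (inord k)) //= (bigD1 (inord k.+1)) 1?eq_sym //=.
rewrite tL tR [X in _ + X + _]big1 => [|j /andP[ja jb]]; last first.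
  by rewrite (tD j) // subrr mulr0 normr0 mulr0.
rewrite (bigD1 (inord k.+1)) 1?eq_sym //= (bigD1 (inord k)) //=.
rewrite tL tR [X in _ + (_ + X + _)]big1 => [|j /andP[ja jb]]; last first.
  by rewrite (tD j) // subrr mulr0 normr0 mulr0.
rewrite [X in _ + (_ + X)]big1 => [|i /andP[ia ib]]; last first.
  by rewrite big1 // => j ji; rewrite (tD i) // subrr mul0r normr0 mulr0.
rewrite -(opprB (mean (inord k)) (mean (inord k.+1))) mulrN mulNr !normrN.
rewrite -expr2 ger0_norm ?sqr_ge0 // le_eqVlt; apply/orP; left; apply/eqP; ring.
Qed.

(** The diagonal terms psi(j,j) <= 1 produce the first sum; dropping i = j from
    the column sums of m H costs only a nonnegative entry of H. *)
Let copy_part :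
  \sum_i \sum_(j | j != i) m i * m j * (\sum_k H i k * psi k j)
  <= \sum_i \sum_(j | j != i) m i * m j * H i j
     + \sum_i \sum_(j | j != i) psi i j * m j * (\sum_k m k * H k i).
Proof.
rewrite sum_offdiag_swap [X in X + _]sum_offdiag_swap [X in _ + X]sum_offdiag_swap.
rewrite -big_split; apply: ler_sum => j _ /=.
have -> : \sum_(i | i != j) m i * m j * (\sum_k H i k * psi k j)
    = \sum_k psi k j * m j * (\sum_(i | i != j) m i * H i k).
  under eq_bigr do rewrite mulr_sumr.
  rewrite exchange_big; apply: eq_bigr => k _ /=.
  by rewrite mulr_sumr; apply: eq_bigr => i _; ring.
rewrite (bigD1 j) //= lerD //.
  rewrite -mulrA mulr_sumr -[leRHS]mul1r ler_pM //.
  - exact: normr_ge0.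
  - by apply: sumr_ge0 => i ij; rewrite !mulr_ge0 ?H_ge0.
  - exact: normr_cov_le1.
  - by rewrite le_eqVlt; apply/orP; left; apply/eqP; apply: eq_bigr => i _; ring.
apply: ler_sum => k kj; apply: ler_wpM2l; first by rewrite mulr_ge0 ?normr_ge0.
by rewrite [leRHS](bigD1 j) //= lerDr mulr_ge0 ?H_ge0 // eq_sym.
Qed.

(** The covariance estimate, for an arbitrary weight m.  It is useful when m is
    excessive for the walk killed according to H, that is lap m + m H <= 0. *)
Lemma weighted_cov_bound :
  \sum_i \sum_(j | j != i) psi i j * m j * - (lap m i + \sum_k m k * H k i)
  <= \sum_i \sum_(j | j != i) m i * m j * H i j
     + \sum_(0 <= k < n) m (inord k) * m (inord k.+1)
          * (mean (inord k) - mean (inord k.+1)) ^+ 2.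
Proof.
pose E i j := \sum_(0 <= k < n) (psi (bond n k i) (bond n k j) - psi i j
         + `|(mean (bond n k i) - mean i) * (mean (bond n k j) - mean j)|).
pose T i j := \sum_k H i k * psi k j.
have ge0 : 0 <= \sum_i \sum_(j | j != i) m i * m j * (E i j + (T i j + T j i)).
  apply: sumr_ge0 => i _; apply: sumr_ge0 => j ji; apply: mulr_ge0.
    exact: mulr_ge0.
  by apply: abs_cov_ineq; rewrite eq_sym.
have Esum : \sum_i \sum_(j | j != i) m i * m j * E i j <=
   2 * (\sum_i \sum_(j | j != i) psi i j * m j * lap m i)
   + 2 * \sum_(0 <= k < n) m (inord k) * m (inord k.+1)
          * (mean (inord k) - mean (inord k.+1)) ^+ 2.
  have -> : \sum_i \sum_(j | j != i) psi i j * m j * lap m i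
      = \sum_(0 <= k < n) \sum_i \sum_(j | j != i)
            psi i j * m j * (m (bond n k i) - m i).
    under eq_bigr do (under eq_bigr do rewrite /lap mulr_sumr; rewrite exchange_big).
    by rewrite exchange_big.
  under eq_bigr do (under eq_bigr do rewrite /E mulr_sumr; rewrite exchange_big).
  rewrite exchange_big !mulr_sumr -big_split /= big_nat [leRHS]big_nat.
  by apply: ler_sum => k /andP[_ lt_kn]; apply: exclusion_part.
have TC : \sum_i \sum_(j | j != i) m i * m j * T j i
    = \sum_i \sum_(j | j != i) m i * m j * T i j.
  rewrite sum_offdiag_swap; apply: eq_bigr => i _; apply: eq_bigr => j _.
  by rewrite [m j * _]mulrC.
have split3 : \sum_i \sum_(j | j != i) m i * m j * (E i j + (T i j + T j i))
   = \sum_i \sum_(j | j != i) m i * m j * E i j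
     + 2 * \sum_i \sum_(j | j != i) m i * m j * T i j.
  rewrite [X in _ = _ + X]mulrDl mul1r -[X in _ = _ + (_ + X)]TC -!big_split /=.
  apply: eq_bigr => i _; rewrite -!big_split /=; apply: eq_bigr => j _.
  by rewrite !mulrDr.
have lhsE : \sum_i \sum_(j | j != i) psi i j * m j * - (lap m i + \sum_k m k * H k i)
  = - (\sum_i \sum_(j | j != i) psi i j * m j * lap m i
     + \sum_i \sum_(j | j != i) psi i j * m j * (\sum_k m k * H k i)).
  rewrite -big_split -sumrN; apply: eq_bigr => i _ /=.
  by rewrite -big_split -sumrN; apply: eq_bigr => j _ /=; rewrite mulrN mulrDr.
have := copy_part; rewrite lhsE -/(T _ _) => Tsum.
move: ge0; rewrite split3; lra.
Qed.
End Moments.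

(** * The maximum principle for a killed walk *)

Section KilledWalk.
Variables (R : realType) (n : nat) (H : 'I_n.+1 -> 'I_n.+1 -> R).
Hypothesis H_offdiag : forall i k, i != k -> 0 <= H i k.
Hypothesis H_rowsum : forall i, \sum_k H i k <= 0.
Variable i0 : 'I_n.+1.
Hypothesis H_killing : \sum_k H i0 k < 0.

(** At a positive maximum of a subharmonic g all terms vanish, so the maximum
    propagates along the path until the site where mass is killed. *)
Lemma maximum_principle (g : 'I_n.+1 -> R) :
  (forall i, 0 <= lap g i + \sum_k H i k * g k) -> forall i, g i <= 0.
Proof.
move=> sub; pose top := [arg max_(i > i0) g i]%O.
have g_le i : g i <= g top.
  by rewrite /top; case: arg_maxP => // j _ /(_ i isT).
suff top_le0 : g top <= 0 by move=> i; apply: le_trans (g_le i) top_le0.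
rewrite leNgt; apply/negP => top_gt0.
have Hg i : g i = g top -> \sum_k H i k * g k <= g top * \sum_k H i k.
  move=> gi; rewrite mulr_sumr; apply: ler_sum => k _; rewrite [leRHS]mulrC.
  by have [<-|ik] := eqVneq i k; rewrite ?gi // ler_wpM2l ?H_offdiag.
have lap_le0 i : g i = g top -> lap g i <= 0.
  by move=> gi; apply: sumr_le0 => k _; rewrite gi subr_le0.
have flat i : g i = g top -> forall k, (k < n)%N -> g (bond n k i) = g top.
  move=> gi k lt_kn; apply/eqP; rewrite eq_le g_le /=.
  have : 0 <= lap g i.
    apply: le_trans (sub i) _; rewrite gerDl; apply: le_trans (Hg i gi) _.
    by rewrite pmulr_rle0.
  rewrite /lap big_mkord (bigD1 (Ordinal lt_kn)) //= gi => ge0.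
  rewrite -subr_ge0; apply: le_trans ge0 _; rewrite gerDl.
  by apply: sumr_le0 => l _; rewrite subr_le0.
have all_top i : (i <= n)%N -> g (inord i) = g top.
  move: i; apply: (@path_connected n _ top).
  - by rewrite -ltnS.
  - by rewrite inord_val.
  - move=> i lt_in; split=> /flat/(_ _ lt_in) <-; congr g.
      by rewrite /bond tpermL.
    by rewrite /bond tpermR.
have gi0 : g i0 = g top by rewrite -(inord_val i0) all_top // -ltnS.
have := sub i0; apply/negP; rewrite -ltNge.
apply: le_lt_trans (lerD (lap_le0 _ gi0) (Hg _ gi0)) _.
by rewrite add0r pmulr_rlt0.
Qed.

Definition lap_mx (B : 'I_n.+1 -> 'I_n.+1 -> R) : 'M[R]_n.+1 :=
  \matrix_(i, j) (lap (fun l => (l == j)%:R) i + B i j).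

Lemma lap_mx_row B (x : 'I_n.+1 -> R) i :
  \sum_j lap_mx B i j * x j = lap x i + \sum_j B i j * x j.
Proof.
under eq_bigr do rewrite mxE mulrDl.
rewrite big_split /=; congr (_ + _).
under eq_bigr do rewrite /lap mulr_suml.
rewrite exchange_big; apply: eq_bigr => k _ /=.
under eq_bigr do rewrite mulrBl.
rewrite sumrB (bigD1 (bond n k i)) //= eqxx mul1r big1 => [|j jb]; last first.
  by rewrite eq_sym (negPf jb) mul0r.
rewrite (bigD1 i) //= eqxx mul1r big1 ?addr0 // => j ji.
by rewrite eq_sym (negPf ji) mul0r.
Qed.

(** The Laplacian is symmetric, because each exchange is an involution. *)
Lemma lap_mx_col B (x : 'I_n.+1 -> R) j :
  \sum_i x i * lap_mx B i j = lap x j + \sum_i x i * B i j.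
Proof.
have tr i : lap_mx B i j = lap_mx (fun a b => B b a) j i.
  rewrite !mxE; congr (_ + _); apply: eq_bigr => k _.
  by rewrite (inv_eq (@bondK n k)) !(eq_sym _ i).
under eq_bigr do rewrite mulrC tr.
by rewrite lap_mx_row; under eq_bigr do rewrite mulrC.
Qed.

(** If x is in the kernel then |x| is subharmonic for the dominating H. *)
Lemma lap_mx_unit (B : 'I_n.+1 -> 'I_n.+1 -> R) :
  (forall i k, i != k -> `|B i k| <= H i k) -> (forall i, B i i <= H i i) ->
  lap_mx B \in unitmx.
Proof.
move=> B_le B_diag; rewrite unitmxE unitfE -det_tr; apply/negP => /det0P[u u0 uB].
pose x j := u 0 j.
have Bx i : lap x i + \sum_k B i k * x k = 0.
  rewrite -lap_mx_row; transitivity ((u *m (lap_mx B)^T) 0 i).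
    by rewrite mxE; apply: eq_bigr => j _; rewrite [in RHS]mxE mulrC.
  by rewrite uB mxE.
have abs_le0 : forall i, `|x i| <= 0.
  apply: maximum_principle => i; pose s : R := Num.sg (x i).
  have s_le := sg_mul_le_norm (x i); rewrite -/s in s_le.
  have sBx : s * (lap x i + \sum_k B i k * x k) = 0 by rewrite Bx mulr0.
  rewrite -[leLHS]sBx.
  rewrite /lap mulrDr !mulr_sumr lerD //; apply: ler_sum => k _.
    by rewrite mulrBr lerB ?s_le // /s -normrEsg.
  have [<-|ik] := eqVneq i k.
    by rewrite mulrCA /s -normrEsg ler_wpM2r ?B_diag.
  apply: le_trans (s_le _) _; rewrite normrM ler_wpM2r //; exact: B_le.
case/negP: u0; apply/eqP/rowP => j; rewrite mxE; apply/eqP.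
by rewrite -normr_le0; exact: abs_le0.
Qed.

(** v i is the Green function G(z, i), the expected time spent at i by the walk
    started from z; it is nonnegative by the maximum principle in z. *)
Lemma green_row (z : 'I_n.+1) : exists v : 'I_n.+1 -> R,
  (forall i, 0 <= v i) /\
  forall j, lap v j + \sum_i v i * H i j = - (j == z)%:R.
Proof.
have Hunit : lap_mx H \in unitmx.
  by apply: lap_mx_unit => // i k ik; rewrite ger0_norm ?H_offdiag.
pose G := invmx (lap_mx H).
exists (fun i => - G z i); split=> [i|j].
  rewrite oppr_ge0; move: z; apply: maximum_principle => k.
  rewrite -lap_mx_row; have /matrixP/(_ k i) := mulmxV Hunit.
  by rewrite !mxE => ->; rewrite ler0n.
rewrite -lap_mx_col; have /matrixP/(_ z j) := mulVmx Hunit.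
rewrite !mxE (eq_sym j) => <-; rewrite -sumrN; apply: eq_bigr => i _.
by rewrite mulNr.
Qed.

Lemma point_source_response (B : 'I_n.+1 -> 'I_n.+1 -> R) (z : 'I_n.+1) :
  (forall i k, i != k -> `|B i k| <= H i k) -> (forall i, B i i <= H i i) ->
  exists u : 'I_n.+1 -> R, forall (x : 'I_n.+1 -> R) (t : R),
    (forall i, lap x i + \sum_k B i k * x k = t * (i == z)%:R) ->
    forall i, x i = t * u i.
Proof.
move=> B_le B_diag; have Bunit := lap_mx_unit B_le B_diag.
exists (fun i => invmx (lap_mx B) i z) => x t Bx i.
have: lap_mx B *m (\col_j x j) = t *: delta_mx z 0.
  apply/colP => k; rewrite !mxE eqxx andbT -Bx -lap_mx_row.
  by apply: eq_bigr => j _; rewrite !mxE.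
move/(congr1 (mulmx (invmx (lap_mx B)))); rewrite mulmxA mulVmx // mul1mx.
by move/colP/(_ i); rewrite -scalemxAr -colE !mxE.
Qed.
End KilledWalk.

(** * Embedding the boundary sites in a longer path *)

Lemma bulk_index_le p N (i : 'I_(p + N.-1).+1) : (i - p <= N)%N.
Proof. by have := ltn_ord i; lia. Qed.

Section Fibers.
Variables (R : realType) (p n : nat).
Local Notation emb j := (@inord n (j : 'I_p.+1)).

(** Push-forward of a function along the embedding of the boundary sites: it is
    supported on their images, where it keeps its values. *)
Definition push1 (x : 'I_p.+1 -> R) (i : 'I_n.+1) : R := \sum_(j | emb j == i) x j.

Definition push2 (M : 'I_p.+1 -> 'I_p.+1 -> R) (i k : 'I_n.+1) : R :=
  \sum_(j | emb j == i) push1 (M j) k.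

Lemma sum_push1 (x : 'I_p.+1 -> R) (y : 'I_n.+1 -> R) :
  \sum_i push1 x i * y i = \sum_j x j * y (emb j).
Proof.
rewrite [RHS](partition_big (fun j : 'I_p.+1 => emb j) predT) //=; apply: eq_bigr => i _.
by rewrite mulr_suml; apply: eq_bigr => j /eqP ->.
Qed.

Lemma push2_row M i (y : 'I_n.+1 -> R) :
  \sum_k push2 M i k * y k = push1 (fun j => \sum_l M j l * y (emb l)) i.
Proof.
under eq_bigr do rewrite mulr_suml.
by rewrite exchange_big; apply: eq_bigr => j _; rewrite sum_push1.
Qed.

Lemma push2_col M k (y : 'I_n.+1 -> R) :
  \sum_i y i * push2 M i k = push1 (fun l => \sum_j y (emb j) * M j l) k.
Proof.
have push2E i : push2 M i k = push1 (fun j => push1 (M j) k) i by [].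
under eq_bigr do rewrite push2E mulrC.
rewrite sum_push1 /push1; under eq_bigr do rewrite mulr_suml.
by rewrite exchange_big; apply: eq_bigr => l _; apply: eq_bigr => j _; rewrite mulrC.
Qed.

Hypothesis le_pn : (p <= n)%N.

Lemma emb_val (j : 'I_p.+1) : emb j = j :> nat.
Proof. by rewrite inordK // ltnS (leq_trans _ le_pn) // -ltnS. Qed.

Lemma push1_emb (x : 'I_p.+1 -> R) (j : 'I_p.+1) : push1 x (emb j) = x j.
Proof.
rewrite /push1 (big_pred1 j) // => l.
by rewrite /= -!val_eqE /= !emb_val.
Qed.

Lemma push1_out (x : 'I_p.+1 -> R) (i : 'I_n.+1) : (p < i)%N -> push1 x i = 0.
Proof.
move=> lt_pi; rewrite /push1 big_pred0 // => j; rewrite -val_eqE /= emb_val.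
by apply: contraTF lt_pi => /eqP <-; rewrite -leqNgt -ltnS.
Qed.

Lemma push1_ge0 (x : 'I_p.+1 -> R) (i : 'I_n.+1) : (forall j, 0 <= x j) -> 0 <= push1 x i.
Proof. by move=> x0; apply: sumr_ge0. Qed.

Lemma push2_diag_le (M M' : 'I_p.+1 -> 'I_p.+1 -> R) i :
  (forall j, M j j <= M' j j) -> push2 M i i <= push2 M' i i.
Proof.
move=> le_diag; apply: ler_sum => j /eqP <-.
by rewrite !push1_emb.
Qed.

Lemma push2_offdiag_le (M M' : 'I_p.+1 -> 'I_p.+1 -> R) i k :
  (forall j l, j != l -> `|M j l| <= M' j l) -> i != k ->
  `|push2 M i k| <= push2 M' i k.
Proof.
move=> le_off ik; apply: le_trans (ler_norm_sum _ _ _) _.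
apply: ler_sum => j /eqP ji; apply: le_trans (ler_norm_sum _ _ _) _.
apply: ler_sum => l /eqP lk; apply: le_off.
by apply: contra_neq ik; rewrite -ji -lk => ->.
Qed.

(** The two Laplacians differ only at the site 0, by the flux from the bulk. *)
Lemma lap_emb (h : nat -> R) (j : 'I_p.+1) : (p < n)%N ->
  lap (fun i : 'I_n.+1 => h i) (emb j)
  = lap (fun i : 'I_p.+1 => h i) j + (h p.+1 - h p) * (j == ord_max)%:R.
Proof.
move=> lt_pn; rewrite !lapE emb_val -addrA; congr (_ + _).
have jp : (j <= p)%N by rewrite -ltnS.
rewrite -val_eqE /= (leq_ltn_trans jp lt_pn) ltn_neqAle jp andbT.
by case: eqP => [->|_] /=; rewrite ?mulr1 ?add0r ?mulr0 ?addr0.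
Qed.
End Fibers.

(** * The boundary dynamics *)

Section Model.
Variables (R : realType) (p : nat) (beta : R).
Variables (r alpha : 'I_p.+1 -> R) (c a : 'I_p.+1 -> 'I_p.+1 -> R).

Definition left_rate n (j : 'I_p.+1) (eta : conf n) : R :=
  r j * (alpha j * (1 - occ R eta (inord j)) + occ R eta (inord j) * (1 - alpha j))
  + \sum_k c j k * (occ R eta (inord k) * (1 - occ R eta (inord j))
                    + occ R eta (inord j) * (1 - occ R eta (inord k)))
  + \sum_k a j k * (occ R eta (inord k) * occ R eta (inord j)
                    + (1 - occ R eta (inord j)) * (1 - occ R eta (inord k))).

Definition left_w n (i : 'I_n.+1) (eta : conf n) : R :=
  push1 (fun j => left_rate j eta) i.

Lemma left_flips n (f : conf n -> R) eta :
  LR r alpha f eta + LC c f eta + LA a f eta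
  = \sum_i left_w i eta * (f (flip i eta) - f eta).
Proof.
rewrite (sum_push1 (fun j => left_rate j eta) (fun i => f (flip i eta) - f eta)).
rewrite /LR /LC /LA -!big_split /=; apply: eq_bigr => j _.
by rewrite /left_rate !mulrDl !mulr_suml.
Qed.

Lemma Ll_flip_exclusion : @Ll R p p r alpha c a = flip_exclusion (@left_w p).
Proof.
apply/funext => f; apply/funext => eta.
by rewrite /Ll /flip_exclusion /LS -left_flips !addrA.
Qed.

Definition full_w N (i : 'I_(p + N.-1).+1) (eta : conf (p + N.-1)) : R :=
  left_w i eta
  + (i == ord_max)%:R * (beta * (1 - occ R eta i) + (1 - beta) * occ R eta i).

(** The bonds of the small system, the bond between 0 and 1 and the bulk bonds
    are the consecutive bonds of the whole path. *)
Lemma LN_flip_exclusion N : (2 <= N)%N ->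
  @LN R p N beta r alpha c a = flip_exclusion (@full_w N).
Proof.
move=> N2; apply/funext => f; apply/funext => eta.
have maxE : inord (p + N.-1) = ord_max :> 'I_(p + N.-1).+1.
  by apply/val_inj; rewrite /= inordK.
rewrite /LN /flip_exclusion /Ll /L01 /LS /Lb /Lr maxE /full_w.
under [X in _ = _ + X]eq_bigr do rewrite mulrDl -mulrA.
rewrite [X in _ = _ + X]big_split /= -left_flips.
rewrite [X in _ = _ + (_ + X)](bigD1 ord_max) //= eqxx mul1r.
rewrite [X in _ = _ + (_ + (_ + X))]big1; last first.
  by move=> i /negPf ->; rewrite mul0r.
have -> : \sum_(0 <= k < p + N.-1) (f (exch (inord k) (inord k.+1) eta) - f eta)
  = \sum_(0 <= k < p) (f (exch (inord k) (inord k.+1) eta) - f eta)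
    + (f (exch (inord p) (inord p.+1) eta) - f eta)
    + \sum_(1 <= k < N.-1) (f (exch (inord (p + k)) (inord (p + k.+1)) eta) - f eta).
  have lt_p : (p < p + N.-1)%N by lia.
  rewrite (big_cat_nat (n := p)) ?leq_addr //= -addrA; congr (_ + _).
  rewrite big_ltn //; congr (_ + _).
  rewrite -{1}[p.+1]addn1 addnC -[in X in \sum_(_ <= _ < X) _](addnC N.-1) big_addn addnK.
  by apply: eq_bigr => k _; rewrite (addnC k p) addnS.
rewrite addr0; ring.
Qed.

Definition left_drift (j : 'I_p.+1) : R := r j * alpha j + \sum_k a j k.

(** The rate at which the occupation of j is renewed, from the reservoir or from
    another site. *)
Definition left_out (j : 'I_p.+1) : R := r j + \sum_k (c j k + a j k).

Definition left_B (j k : 'I_p.+1) : R := c j k - a j k - (j == k)%:R * left_out j.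

(** The absolute values of the off-diagonal entries of left_B, up to
    |c - a| <= c + a: the signs of the anti-copying terms are forgotten. *)
Definition left_H (j k : 'I_p.+1) : R := c j k + a j k - (j == k)%:R * left_out j.

(** The choice of the three boundary dynamics enters the proof only here: the
    quadratic terms of the rates cancel since occupation numbers are 0 or 1. *)
Lemma left_rate_drift n (j : 'I_p.+1) (eta : conf n) :
  left_rate j eta * (1 - 2 * occ R eta (inord j))
  = left_drift j + \sum_k left_B j k * occ R eta (inord k).
Proof.
pose e := occ R eta (inord j); have e2 : e * e = e by apply: occ_sqr.
have -> : \sum_k left_B j k * occ R eta (inord k)
   = \sum_k (c j k - a j k) * occ R eta (inord k) - left_out j * e.
  under eq_bigr do rewrite mulrBl.
  rewrite sumrB; congr (_ - _).
  rewrite (bigD1 j) //= eqxx mul1r big1 ?addr0 // => k kj.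
  by rewrite eq_sym (negPf kj) !mul0r.
rewrite /left_rate /left_drift /left_out -/e mulrDl (mulrDl (r j * _)) !mulr_suml.
have -> : r j * (alpha j * (1 - e) + e * (1 - alpha j)) * (1 - 2 * e)
     = r j * alpha j - r j * e.
  transitivity (r j * alpha j - r j * e
                - (4 * r j * alpha j - 2 * r j) * (e - e * e)); first by ring.
  by rewrite e2 subrr mulr0 subr0.
have -> : r j * alpha j - r j * e
  + \sum_i c j i * (occ R eta (inord i) * (1 - e) + e * (1 - occ R eta (inord i))) * (1 - 2 * e)
  + \sum_i a j i * (occ R eta (inord i) * e + (1 - e) * (1 - occ R eta (inord i))) * (1 - 2 * e)
  = r j * alpha j - r j * e
   + \sum_i (a j i + ((c j i - a j i) * occ R eta (inord i) - (c j i + a j i) * e)).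
  rewrite -addrA -big_split /=; congr (_ + _); apply: eq_bigr => k _.
  set x := occ R eta (inord k).
  transitivity (a j k + ((c j k - a j k) * x - (c j k + a j k) * e)
                + (c j k - a j k) * (2 - 4 * x) * (e - e * e)); first by ring.
  by rewrite e2 subrr mulr0 addr0.
rewrite big_split /= sumrB -mulr_suml; ring.
Qed.
(** * Uniqueness of the stationary states *)

Hypothesis beta01 : 0 < beta < 1.
Hypothesis r_ge0 : forall j, 0 <= r j.
Hypothesis alpha01 : forall j, 0 <= alpha j <= 1.
Hypothesis c_ge0 : forall j k, 0 <= c j k.
Hypothesis a_ge0 : forall j k, 0 <= a j k.
Hypothesis r_sum : 0 < \sum_j r j.

Let reservoir : exists j, 0 < r j.
Proof.
apply/existsP; rewrite -[X in is_true X]negbK negb_exists; apply/negP => /forallP r_le0.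
by move: r_sum; rewrite big1 ?ltxx // => j _; apply/eqP; rewrite eq_le r_ge0 leNgt r_le0.
Qed.

Let occ_ge0 n (eta : conf n) i : 0 <= occ R eta i.
Proof. by case/andP: (occ_itv R eta i). Qed.

Let vac_ge0 n (eta : conf n) i : 0 <= 1 - occ R eta i.
Proof. by rewrite subr_ge0; case/andP: (occ_itv R eta i). Qed.

Let reservoir_rate_le n j (eta : conf n) :
  r j * (alpha j * (1 - occ R eta (inord j)) + occ R eta (inord j) * (1 - alpha j))
  <= left_rate j eta.
Proof.
rewrite /left_rate -addrA lerDl addr_ge0 //; apply: sumr_ge0 => k _.
  by rewrite mulr_ge0 // addr_ge0 // mulr_ge0.
by rewrite mulr_ge0 // addr_ge0 // mulr_ge0.
Qed.

Let left_rate_ge0 n j (eta : conf n) : 0 <= left_rate j eta.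
Proof.
apply: le_trans (reservoir_rate_le j eta); have /andP[al0 al1] := alpha01 j.
by rewrite mulr_ge0 // addr_ge0 // mulr_ge0 // subr_ge0.
Qed.

Let left_w_ge0 n (i : 'I_n.+1) (eta : conf n) : 0 <= left_w i eta.
Proof. by apply: push1_ge0 => j; apply: left_rate_ge0. Qed.

(** The reservoir at a site with r_j > 0 can fill it if alpha_j > 0, and can empty
    it otherwise. *)
Lemma left_unique_stationary :
  exists! mu : {ffun conf p -> R}, stationary (Ll r alpha c a) mu.
Proof.
have [j rj] := reservoir; have /andP[al0 al1] := alpha01 j; rewrite Ll_flip_exclusion.
apply: (flip_exclusion_unique_stationary _ (i0 := j) (b := 0 < alpha j)) => // eta etaj.
have jE : inord j = j by apply: inord_val.
rewrite -[in left_w j eta]jE /left_w push1_emb //.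
apply: lt_le_trans (reservoir_rate_le j eta); rewrite jE pmulr_rgt0 // /occ.
move: etaj; case: ltP => al; case: (eta j) => //= _.
  by rewrite subr0 mulr1 mul0r addr0.
by rewrite subrr mulr0 add0r mul1r; lra.
Qed.

Let full_w_ge0 N i (eta : conf (p + N.-1)) : 0 <= full_w i eta.
Proof.
have /andP[b0 b1] := beta01.
by rewrite addr_ge0 // mulr_ge0 // addr_ge0 // mulr_ge0 //; lra.
Qed.

Lemma full_unique_stationary N : (2 <= N)%N ->
  exists! mu : {ffun conf (p + N.-1) -> R}, stationary (@LN R p N beta r alpha c a) mu.
Proof.
move=> N2; have /andP[b0 b1] := beta01; rewrite LN_flip_exclusion //.
apply: (flip_exclusion_unique_stationary _ (i0 := ord_max) (b := true)) => // eta.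
rewrite /full_w eqxx mul1r /occ; case: (eta _) => //= _.
by rewrite subr0 mulr1 mulr0 addr0 ltr_wpDl.
Qed.

Let left_B_le j k : j != k -> `|left_B j k| <= left_H j k.
Proof.
move=> /negPf jk; rewrite /left_B /left_H jk mul0r !subr0.
have := c_ge0 j k; have := a_ge0 j k.
by rewrite ler_norml => ? ?; apply/andP; split; lra.
Qed.

Let left_B_diag j : left_B j j <= left_H j j.
Proof. by rewrite lerD2r; have := a_ge0 j j; lra. Qed.

Let left_H_ge0 j k : j != k -> 0 <= left_H j k.
Proof. by move/left_B_le; apply: le_trans. Qed.

Let left_H_rowsum j : \sum_k left_H j k = - r j.
Proof.
rewrite sumrB [X in _ - X](bigD1 j) //= eqxx mul1r [X in _ - (_ + X)]big1 => [|k kj].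
  by rewrite /left_out addr0 opprD addrCA subrr addr0.
by rewrite eq_sym (negPf kj) mul0r.
Qed.

Let left_H_rowsum_le0 j : \sum_k left_H j k <= 0.
Proof. by rewrite left_H_rowsum oppr_le0. Qed.

Let left_H_killing : exists j, \sum_k left_H j k < 0.
Proof. by have [j rj] := reservoir; exists j; rewrite left_H_rowsum oppr_lt0. Qed.

(** * The density profile and the covariances for fixed N *)

Section FixedN.
Variable N : nat.
Hypothesis N2 : (2 <= N)%N.
Variable muN : {ffun conf (p + N.-1) -> R}.
Hypothesis muN_stat : stationary (@LN R p N beta r alpha c a) muN.
Local Notation n := (p + N.-1)%N.

Let lt_pn : (p < n)%N. Proof. by move: N2; lia. Qed.
Let le_pn : (p <= n)%N. Proof. exact: ltnW. Qed.
Let N_gt0 : 0 < N%:R :> R. Proof. by rewrite ltr0n ltnW. Qed.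

Let muN_flip_exclusion : stationary (flip_exclusion (@full_w N)) muN.
Proof. by rewrite -LN_flip_exclusion. Qed.

Let muN_prob : is_prob muN := muN_stat.1.

Let corner (i k : 'I_n.+1) : R := ((i == ord_max) && (k == ord_max))%:R.

Definition full_b (i : 'I_n.+1) : R := push1 left_drift i + (i == ord_max)%:R * beta.
Definition full_B (i k : 'I_n.+1) : R := push2 left_B i k - corner i k.
Definition full_H (i k : 'I_n.+1) : R := push2 left_H i k - corner i k.

Let sum_corner_row i (x : 'I_n.+1 -> R) :
  \sum_k corner i k * x k = (i == ord_max)%:R * x ord_max.
Proof.
rewrite (bigD1 ord_max) //= /corner eqxx andbT big1 ?addr0 // => k /negPf ->.
by rewrite andbF mul0r.
Qed.

Lemma full_drift i (eta : conf n) :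
  full_w i eta * (1 - 2 * occ R eta i)
  = full_b i + \sum_k full_B i k * occ R eta k.
Proof.
under eq_bigr do rewrite /full_B mulrBl.
rewrite sumrB sum_corner_row push2_row /full_w mulrDl.
have -> : left_w i eta * (1 - 2 * occ R eta i)
   = push1 left_drift i
     + push1 (fun j => \sum_l left_B j l * occ R eta (inord l)) i.
  rewrite /left_w /push1 mulr_suml -big_split /=; apply: eq_bigr => j /eqP <-.
  exact: left_rate_drift.
rewrite /full_b; have [->|_] := eqVneq i ord_max; last by rewrite !mul0r; ring.
rewrite !mul1r.
set e := occ R eta ord_max; have e2 : e * e = e by apply: occ_sqr.
set x := push1 _ _; set y := push1 _ _.
transitivity (x + beta + (y - e) + (2 - 4 * beta) * (e - e * e)); first by ring.
by rewrite e2 subrr mulr0 addr0; ring.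
Qed.

Let full_B_le i k : i != k -> `|full_B i k| <= full_H i k.
Proof.
move=> ik; rewrite /full_B /full_H.
have -> : corner i k = 0.
  rewrite /corner; case: eqP => // iE; case: eqP => // kE.
  by rewrite iE kE eqxx in ik.
by rewrite !subr0; apply: push2_offdiag_le.
Qed.

Let full_B_diag i : full_B i i <= full_H i i.
Proof. by rewrite lerD2r push2_diag_le. Qed.

(* the profile as a function of a natural number, to step from site to site *)
Let M k := mean muN (inord k).

Let M_val (i : 'I_n.+1) : M i = mean muN i. Proof. by rewrite /M inord_val. Qed.

Let profile_eq i :
  lap (fun i : 'I_n.+1 => M i) i + push1 left_drift i
  + push1 (fun j => \sum_l left_B j l * M l) i
  + (i == ord_max)%:R * (beta - M n) = 0.
Proof.
have Mmean : (fun i : 'I_n.+1 => M i) = mean muN by apply/funext.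
rewrite Mmean -[RHS](mean_eq full_drift muN_flip_exclusion i).
under [X in _ = _ + X]eq_bigr do rewrite /full_B mulrBl.
rewrite sumrB sum_corner_row push2_row /full_b -(M_val ord_max) mulrBr.
rewrite /M /=; ring.
Qed.

(** The stationary current, up to sign: in the bulk it is the constant gradient
    of the profile. *)
Definition slope : R := M p.+1 - M p.

(** Seen from the boundary sites, the rest of the system is a source at site 0. *)
Lemma profile_left (j : 'I_p.+1) :
  lap (fun j : 'I_p.+1 => M j) j + left_drift j + \sum_l left_B j l * M l
  + slope * (j == ord_max)%:R = 0.
Proof.
have := profile_eq (inord j).
rewrite (lap_emb le_pn M j lt_pn) !push1_emb // -[inord _ == _]val_eqE /= emb_val //.
have -> : (j == n :> nat) = false.
  by apply/eqP => jn; have := ltn_ord j; rewrite jn ltnS leqNgt lt_pn.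
by rewrite mul0r addr0 /slope => E; rewrite -[RHS]E; ring.
Qed.

Let profile_step k : (k < N.-1)%N -> M (p + k.+1) - M (p + k) = slope.
Proof.
elim: k => [|k IH] kN; first by rewrite addn0 addn1.
rewrite -IH; last by lia.
have lt_i : (p + k.+1 < n.+1)%N by lia.
have := profile_eq (Ordinal lt_i); rewrite lapE /= !push1_out //=; try by lia.
rewrite -val_eqE /=.
have -> : (0 < p + k.+1)%N by lia.
have -> : (p + k.+1 < n)%N by lia.
have -> : (p + k.+1 == n) = false by apply/eqP; lia.
rewrite !addr0 mul0r addr0 addnS /= -!addnS => E.
by apply/eqP; rewrite -subr_eq0 -[X in _ == X]E; apply/eqP; ring.
Qed.

Lemma profile_bulk k : (k <= N.-1)%N -> M (p + k) = M p + k%:R * slope.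
Proof.
elim: k => [|k IH] kN; first by rewrite addn0 mul0r addr0.
rewrite -[LHS](subrK (M (p + k))) profile_step // IH; last exact: ltnW.
by rewrite -[in RHS]natr1; ring.
Qed.

(** The reservoir on the right acts as a site N of density beta. *)
Lemma slopeE : N%:R * slope = beta - M p.
Proof.
have := profile_eq ord_max; rewrite lapE /= ltnn !push1_out //= eqxx mul1r.
have -> : (0 < n)%N by lia.
have E : n.-1 = (p + N.-2)%N by lia.
have step : M n - M n.-1 = slope.
  by rewrite E -(@profile_step N.-2) ?(ltn_predL, prednK) //; try lia; congr (M _ - _); lia.
have Mn : M n = M p + N.-1%:R * slope by rewrite profile_bulk.
have NE : N%:R = N.-1%:R + 1 :> R by rewrite natr1 prednK //; lia.
rewrite NE => H0; move: step Mn H0; rewrite !addr0; lra.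
Qed.

Lemma normr_slope_le : `|slope| <= N%:R^-1.
Proof.
rewrite -(ler_pM2l N_gt0) divff ?gt_eqF // -[X in X * _](gtr0_norm N_gt0) -normrM slopeE.
have /andP[? ?] := mean_itv muN_prob (inord p); have /andP[? ?] := beta01.
by rewrite /M ler_norml; apply/andP; split; lra.
Qed.

Variable v : 'I_p.+1 -> R.
Hypothesis v_ge0 : forall j, 0 <= v j.
Hypothesis v_green : forall j,
  lap v j + \sum_i v i * left_H i j = - (j == ord_max)%:R.

Let kappa := v ord_max.

(** On the boundary sites the Green function, in the bulk site l = k - p the
    concave parabola v_0 + l - l^2 / (2N); both expressions agree at l = 0.  The
    initial slope is kept below 1 so that the unit sink of the Green equation at
    site 0 absorbs it; the curvature 1/N is the gain in the bulk. *)
Definition weight (k : nat) : R :=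
  v (inord (minn k p)) + (k - p)%:R - (k - p)%:R ^+ 2 / (2 * N%:R).

Let weight_left k : (k <= p)%N -> weight k = v (inord k).
Proof.
move=> kp; rewrite /weight (minn_idPl kp).
have -> : (k - p = 0)%N by lia.
by rewrite expr0n /= mul0r addr0 subr0.
Qed.

Let weight_bulk l : weight (p + l) = kappa + l%:R - l%:R ^+ 2 / (2 * N%:R).
Proof.
rewrite /weight addKn (minn_idPr (leq_addr _ _)) /kappa.
by have -> : inord p = ord_max :> 'I_p.+1 by apply/val_inj; rewrite /= inordK.
Qed.

Let weight_bulk_ge l : (l <= N)%N -> l%:R / 2 <= weight (p + l).
Proof.
move=> lN; rewrite weight_bulk -addrA.
apply: (@le_trans _ _ (l%:R - l%:R ^+ 2 / (2 * N%:R))); last by rewrite lerDr v_ge0.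
have : l%:R / N%:R <= 1 :> R by rewrite ler_pdivrMr // mul1r ler_nat.
have l0 : 0 <= l%:R :> R by [].
move=> /(ler_wpM2l l0); rewrite mulr1 => le_l.
have -> : l%:R ^+ 2 / (2 * N%:R) = l%:R * (l%:R / N%:R) / 2 :> R.
  by field; rewrite gt_eqF.
lra.
Qed.

Let weight_bulk_le l : (l <= N)%N -> weight (p + l) <= (kappa + 1) * N%:R.
Proof.
move=> lN; rewrite weight_bulk; have : l%:R <= N%:R :> R by rewrite ler_nat.
have k0 : 0 <= kappa by exact: v_ge0.
have : kappa * 1 <= kappa * N%:R by rewrite ler_wpM2l // ler1n; lia.
have : 0 <= l%:R ^+ 2 / (2 * N%:R) :> R by rewrite divr_ge0 // mulr_ge0 // ltW.
lra.
Qed.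

Let weight_ge k : (k <= n)%N -> (k - p)%N%:R / 2 <= weight k.
Proof.
have [kp _|pk kn] := leqP k p.
  have -> : (k - p = 0)%N by lia.
  by rewrite mul0r weight_left.
have {2}-> : k = (p + (k - p))%N by lia.
by apply: weight_bulk_ge; lia.
Qed.

Let weight_ge0 k : (k <= n)%N -> 0 <= weight k.
Proof. by move/weight_ge; apply: le_trans; rewrite divr_ge0. Qed.

Let weight_second_difference l :
  weight (p + l) - weight (p + l.+1) + (weight (p + l.+2) - weight (p + l.+1))
  = - N%:R^-1.
Proof.
by rewrite !weight_bulk -!natr1 -addrA; field; rewrite gt_eqF.
Qed.

(** On the boundary sites the unit sink of the Green equation at site 0
    compensates the flux from the bulk, which is 1 - 1/(2N).  At the last site the
    killing by the reservoir contributes the value of the parabola at N, which is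
    nonnegative. *)
Lemma weight_excessive (i : 'I_n.+1) :
  lap (fun i : 'I_n.+1 => weight i) i + \sum_(k < n.+1) weight k * full_H k i
  <= - ((p < i)%N%:R / N%:R).
Proof.
have -> : \sum_(k < n.+1) weight k * full_H k i
   = push1 (fun l => \sum_(j < p.+1) weight (inord j : 'I_n.+1) * left_H j l) i
     - (i == ord_max)%:R * weight n.
  under eq_bigr do rewrite /full_H mulrBr.
  rewrite sumrB push2_col; congr (_ - _).
  rewrite (bigD1 ord_max) //= /corner eqxx /= mulrC big1 ?addr0 // => k /negPf ->.
  by rewrite mulr0.
have [pi|] := ltnP p i; last first.
  move=> ip; pose j : 'I_p.+1 := inord i.
  have jE : inord j = i by apply/val_inj; rewrite /= emb_val //= inordK.
  rewrite -jE (lap_emb le_pn _ _ lt_pn) push1_emb // jE.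
  have -> : (i == ord_max) = false.
    by rewrite -val_eqE /=; apply/eqP => iE; move: ip; rewrite iE leqNgt lt_pn.
  rewrite !mul0r !oppr0 addr0.
  have -> : lap (fun j : 'I_p.+1 => weight j) j = lap v j.
    by congr lap; apply/funext => l; rewrite weight_left ?inord_val // -ltnS.
  have -> : \sum_(l < p.+1) weight (inord l : 'I_n.+1) * left_H l j = \sum_l v l * left_H l j.
    by apply: eq_bigr => l _; rewrite emb_val // weight_left ?inord_val // -ltnS.
  rewrite addrAC v_green -[X in weight X - _]addn1 -[X in _ - weight X]addn0 !weight_bulk.
  have : 0 < (2 * N%:R)^-1 :> R by rewrite invr_gt0 mulr_gt0.
  case: (_ == _) => /=; rewrite !expr0n !expr1n /=; lra.
rewrite push1_out // add0r lapE /= mul1r.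
have -> : (0 < i)%N by lia.
have [l iE] : exists l, i = (p + l.+1)%N :> nat by exists (i - p.+1)%N; lia.
have sd := weight_second_difference l.
rewrite -val_eqE /= iE [in X in X - _ + _ - _]addnS /=.
have [lt_in|] := ltnP (p + l.+1) n.
  by rewrite ltn_eqF // mul0r subr0 -addnS sd.
move=> le_ni; have nE : n = (p + l.+1)%N.
  by apply/eqP; rewrite eqn_leq le_ni -iE -ltnS ltn_ord.
rewrite nE eqxx mul1r addr0.
have : 0 <= weight (p + l.+2).
  apply: le_trans (weight_bulk_ge _); first by rewrite divr_ge0.
  by move/addnI: nE; lia.
lra.
Qed.

Definition cov_const : R :=
  \sum_i \sum_j v i * v j * `|left_H i j|
  + \sum_(0 <= k < p) v (inord k) * v (inord k.+1) + (kappa + 1) ^+ 2.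

Let m_ge0 (i : 'I_n.+1) : 0 <= weight i.
Proof. by apply: weight_ge0; rewrite -ltnS. Qed.

(** Couplings live on the boundary sites, where the weight does not depend on N. *)
Let coupling_sum_le :
  \sum_(i < n.+1) \sum_(j < n.+1 | j != i) weight i * weight j * full_H i j
    <= \sum_i \sum_j v i * v j * `|left_H i j|.
Proof.
pose absH i j := `|left_H i j|.
have -> : \sum_i \sum_j v i * v j * `|left_H i j|
    = \sum_(i < n.+1) \sum_(j < n.+1) weight i * weight j * push2 absH i j.
  transitivity (\sum_(i < n.+1) push1 (fun l => \sum_k v k * absH l k) i * weight i).
    rewrite sum_push1; apply: eq_bigr => i _.
    rewrite emb_val // weight_left -1?ltnS // inord_val mulr_suml.
    by apply: eq_bigr => j _; rewrite /absH; ring.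
  apply: eq_bigr => i _.
  have -> : push1 (fun l => \sum_k v k * absH l k) i
      = \sum_(j < n.+1) push2 absH i j * weight j.
    rewrite push2_row; apply: eq_bigr => l _; apply: eq_bigr => k _.
    by rewrite emb_val // weight_left -1?ltnS // inord_val mulrC.
  by rewrite mulr_suml; apply: eq_bigr => j _; ring.
apply: ler_sum => i _; rewrite big_mkcond; apply: ler_sum => j _.
have push_ge0 : 0 <= push2 absH i j.
  by apply: push1_ge0 => l; apply: push1_ge0 => k; apply: normr_ge0.
case: ifP => _; last by rewrite !mulr_ge0.
apply: ler_wpM2l; first by rewrite mulr_ge0.
apply: (@le_trans _ _ (push2 left_H i j)); first by rewrite gerBl /corner ler0n.
by apply: ler_sum => l _; apply: ler_sum => k _; apply: ler_norm.
Qed.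

(** Bulk bonds have squared gradient O(1/N^2) and weights O(N). *)
Let gradient_sum_le :
  \sum_(0 <= k < n) weight (inord k : 'I_n.+1) * weight (inord k.+1 : 'I_n.+1)
      * (mean muN (inord k) - mean muN (inord k.+1)) ^+ 2
    <= \sum_(0 <= k < p) v (inord k) * v (inord k.+1) + N%:R * (kappa + 1) ^+ 2.
Proof.
rewrite (big_cat_nat (n := p)) //= lerD //.
  rewrite big_nat [leRHS]big_nat; apply: ler_sum => k /andP[_ kp].
  rewrite !inordK ?weight_left; try by lia.
  rewrite -[leRHS]mulr1 ler_wpM2l ?mulr_ge0 //.
  have /andP[? ?] := mean_itv muN_prob (inord k).
  have /andP[? ?] := mean_itv muN_prob (inord k.+1).
  by rewrite -[leLHS]real_normK ?num_real // expr_le1 // ler_norml; apply/andP; split; lra.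
apply: (@le_trans _ _ (\sum_(p <= k < n) (kappa + 1) ^+ 2)); last first.
  by rewrite sumr_const_nat -[leLHS]mulr_natl ler_wpM2r ?sqr_ge0 // ler_nat; lia.
rewrite big_nat [leRHS]big_nat; apply: ler_sum => k /andP[pk kn].
have kE : k = (p + (k - p))%N by lia.
have lN : (k - p < N.-1)%N by lia.
rewrite !inordK ?ltnS //; last exact: ltnW.
have -> : (mean muN (inord k) - mean muN (inord k.+1)) ^+ 2 = slope ^+ 2.
  by rewrite -sqrrN opprB -(profile_step lN) addnS -kE.
apply: (@le_trans _ _ (((kappa + 1) * N%:R) ^+ 2 * N%:R^-1 ^+ 2)); last first.
  by rewrite -exprMn mulfK ?gt_eqF.
have mle l : (p <= l <= n)%N -> weight l <= (kappa + 1) * N%:R.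
  move=> /andP[pl ln]; have -> : l = (p + (l - p))%N by lia.
  by apply: weight_bulk_le; lia.
apply: ler_pM.
- by rewrite mulr_ge0 ?weight_ge0 //; lia.
- exact: sqr_ge0.
- by rewrite expr2 ler_pM ?weight_ge0 ?mle //; lia.
by rewrite -[leLHS]real_normK ?num_real // lerXn2r ?nnegrE ?normr_slope_le // invr_ge0 ltW.
Qed.

Lemma bulk_cov_bound :
  \sum_(i < n.+1) \sum_(j < n.+1 | j != i)
     `|cov muN i j| * (p < i)%N%:R * (j - p)%N%:R <= 2 * cov_const * N%:R ^+ 2.
Proof.
have := weighted_cov_bound full_drift muN_flip_exclusion full_B_le full_B_diag m_ge0.
set lhs := (X in X <= _ -> _); set rhs := (X in _ <= X -> _) => lhs_le.
have rhs_le : rhs <= cov_const * N%:R.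
  have N1 : 1 <= N%:R :> R by rewrite ler1n; lia.
  apply: le_trans (lerD coupling_sum_le gradient_sum_le) _; rewrite /cov_const.
  set C1 := \sum_i _; set C2 := \sum_(_ <= _ < _) _.
  have C1_ge0 : 0 <= C1 by apply: sumr_ge0 => i _; apply: sumr_ge0 => j _; rewrite !mulr_ge0.
  have C2_ge0 : 0 <= C2 by apply: sumr_ge0 => k _; rewrite mulr_ge0.
  have : (C1 + C2) * 1 <= (C1 + C2) * N%:R by rewrite ler_wpM2l // addr_ge0.
  lra.
suff lhs_ge : (2 * N%:R)^-1 * \sum_(i < n.+1) \sum_(j < n.+1 | j != i)
     `|cov muN i j| * (p < i)%N%:R * (j - p)%N%:R <= lhs.
  have := le_trans lhs_ge (le_trans lhs_le rhs_le).
  rewrite ler_pdivrMl ?mulr_gt0 // => /le_trans; apply.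
  by rewrite le_eqVlt; apply/orP; left; apply/eqP; ring.
rewrite mulr_sumr; apply: ler_sum => i _; rewrite mulr_sumr; apply: ler_sum => j ji.
have := weight_excessive i; rewrite lerNr => exc.
have wj : (j - p)%:R / 2 <= weight j by apply: weight_ge; rewrite -ltnS.
rewrite -!mulrA mulrCA; apply: ler_wpM2l => //.
have -> : (2 * N%:R)^-1 * ((p < i)%N%:R * (j - p)%:R)
   = (j - p)%:R / 2 * ((p < i)%N%:R / N%:R) :> R.
  by field; rewrite gt_eqF.
by apply: ler_pM => //; rewrite divr_ge0 // ltW.
Qed.
End FixedN.

(** * Letting N tend to infinity *)

(** The difference between the two profiles on the boundary sites solves the
    homogeneous equation of the small system with a source of size 1/N at site 0. *)
Lemma profile_near_linear (mu : {ffun conf p -> R}) :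
  stationary (Ll r alpha c a) mu ->
  exists2 C : R, 0 <= C & forall N, (2 <= N)%N ->
    forall muN : {ffun conf (p + N.-1) -> R},
    stationary (@LN R p N beta r alpha c a) muN ->
    forall k, (k < N)%N ->
    `|mean muN (inord (p + k))
      - (mean mu ord_max + (beta - mean mu ord_max) * (k%:R / N%:R))|
      <= C / N%:R.
Proof.
rewrite Ll_flip_exclusion => mu_stat; have [j0 killing] := left_H_killing.
have [u uP] := point_source_response left_H_ge0 left_H_rowsum_le0 killing ord_max
                 left_B_le left_B_diag.
exists `|u ord_max| => // N N2 muN muN_stat k kN.
have N_gt0 : 0 < N%:R :> R by rewrite ltr0n; lia.
pose x (j : 'I_p.+1) := mean muN (inord j).
have left_drift_eq i eta : left_w (i : 'I_p.+1) eta * (1 - 2 * occ R eta i)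
    = left_drift i + \sum_l left_B i l * occ R eta l.
  have iE : inord i = i by apply: inord_val.
  rewrite -[in left_w i eta]iE /left_w push1_emb // -[in occ R eta i]iE left_rate_drift.
  by under eq_bigr do rewrite inord_val.
have x_eq i : x i - mean mu i = - slope muN * u i.
  apply: (uP (fun j => x j - mean mu j)) => {}i.
  have := profile_left N2 muN_stat i; rewrite -/(x _).
  have := mean_eq left_drift_eq mu_stat i.
  have -> : lap (fun j => x j - mean mu j) i = lap x i - lap (mean mu) i.
    by rewrite /lap -sumrB; apply: eq_bigr => l _; ring.
  have -> : \sum_k left_B i k * (x k - mean mu k)
      = \sum_k left_B i k * x k - \sum_k left_B i k * mean mu k.
    by rewrite -sumrB; apply: eq_bigr => l _; rewrite mulrBr.
  rewrite /x; lra.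
have x_max : mean muN (inord p) = mean mu ord_max - slope muN * u ord_max.
  by rewrite -[mean muN _]/(x ord_max) -mulNr -x_eq; ring.
have slN := slopeE N2 muN_stat.
rewrite (profile_bulk N2 muN_stat); last by lia.
have -> : mean muN (inord p) + k%:R * slope muN
    - (mean mu ord_max + (beta - mean mu ord_max) * (k%:R / N%:R))
    = - (slope muN * u ord_max) * (1 - k%:R / N%:R).
  have -> : mean mu ord_max = mean muN (inord p) + slope muN * u ord_max.
    by rewrite x_max subrK.
  have -> : beta = mean muN (inord p) + N%:R * slope muN by rewrite slN addrC subrK.
  by field; rewrite gt_eqF.
have kN1 : 0 <= (k%:R / N%:R : R) <= 1.
  by rewrite divr_ge0 //= ler_pdivrMr // mul1r ler_nat ltnW.
rewrite normrM normrN normrM -[leRHS]mulr1 ler_pM //.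
  by rewrite mulrC ler_wpM2l // normr_slope_le.
by case/andP: kN1 => ? ?; rewrite ler_norml; apply/andP; split; lra.
Qed.

Lemma bulk_sum N (h : nat -> R) : (1 <= N)%N ->
  \sum_(1 <= k < N) h k = \sum_(i < (p + N.-1).+1) (p < i)%N%:R * h (i - p)%N.
Proof.
move=> N1.
rewrite -(big_mkord xpredT (fun i => (p < i)%N%:R * h (i - p)%N)).
rewrite [RHS](big_cat_nat (n := p.+1)) /=; [|by []|by lia].
rewrite [X in _ = X + _]big_nat [X in _ = X + _]big1 ?add0r => [|i /andP[_ ip]]; last first.
  by rewrite ltnNge -ltnS ip mul0r.
rewrite -[p.+1]add1n big_addn.
have -> : ((p + N.-1).+1 - p = N)%N by lia.
rewrite big_nat [RHS]big_nat; apply: eq_bigr => i /andP[i0 _].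
by rewrite addnK -[X in (X < _)%N]add0n ltn_add2r i0 mul1r.
Qed.

(** For a pair of bulk sites at bulk positions k and l, the covariance is bounded
    by 1 if l < K, and by psi l / K otherwise. *)
Lemma second_moment_bound : exists2 C : R, 0 <= C & forall N, (2 <= N)%N ->
  forall muN : {ffun conf (p + N.-1) -> R},
  stationary (@LN R p N beta r alpha c a) muN ->
  forall (g : 'I_(p + N.-1).+1 -> R) (gmax : R),
  (forall i, `|g i| <= gmax * (p < i)%N%:R) ->
  forall K, (0 < K)%N ->
  expect muN (fun eta => (\sum_i g i * dev muN i eta) ^+ 2)
    <= gmax ^+ 2 * (N%:R * (K.+1)%:R + C * N%:R ^+ 2 / K%:R).
Proof.
have [j0 killing] := left_H_killing.
have [v [v_ge0 v_green]] := green_row left_H_ge0 left_H_rowsum_le0 killing ord_max.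
exists (2 * cov_const v).
  rewrite mulr_ge0 // /cov_const !addr_ge0 ?sqr_ge0 //.
    by apply: sumr_ge0 => i _; apply: sumr_ge0 => j _; rewrite !mulr_ge0.
  by apply: sumr_ge0 => k _; rewrite mulr_ge0.
move=> N N2 muN muN_stat g gmax g_le K K0.
have muN_prob : is_prob muN := muN_stat.1.
have cov_sum := bulk_cov_bound N2 muN_stat v_ge0 v_green.
set n := (p + N.-1)%N in muN muN_stat muN_prob g g_le cov_sum *.
pose bulk (i : 'I_n.+1) : R := (p < i)%N%:R.
have gmax_ge0 : 0 <= gmax.
  have := le_trans (normr_ge0 _) (g_le ord_max).
  have -> : (p < (ord_max : 'I_n.+1))%N by rewrite /= /n; lia.
  by rewrite mulr1.
have bulk_le : \sum_i bulk i <= N%:R.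
  under eq_bigr do rewrite -[bulk _]mulr1.
  rewrite -(bulk_sum (fun=> 1)); last by lia.
  by rewrite sumr_const_nat ler_nat; lia.
have near_le : \sum_(i < n.+1) bulk i * (i - p < K)%N%:R <= K%:R.
  rewrite -(bulk_sum (fun k => (k < K)%N%:R)); last by lia.
  have -> : \sum_(1 <= k < N) (k < K)%N%:R = (\sum_(1 <= k < N) (k < K)%N)%:R :> R.
    by rewrite natr_sum.
  rewrite ler_nat.
  have count_le l : (\sum_(0 <= k < l) (k < K) <= minn l K)%N.
    by elim: l => [|l IH]; [rewrite big_geq|rewrite big_nat_recr //=; lia].
  by have := count_le N; rewrite big_ltn /=; lia.
have -> : expect muN (fun eta => (\sum_i g i * dev muN i eta) ^+ 2)
    = \sum_i \sum_j g i * g j * cov muN i j.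
  under eq_expect do rewrite expr2 mulr_suml.
  rewrite expect_sum; apply: eq_bigr => i _.
  under eq_expect do rewrite mulr_sumr.
  rewrite expect_sum; apply: eq_bigr => j _.
  by rewrite /cov -expectZ; apply: eq_expect => x; ring.
have pair_le i j : g i * g j * cov muN i j <= gmax ^+ 2 * (bulk i * bulk j * `|cov muN i j|).
  apply: le_trans (ler_norm _) _; rewrite !normrM.
  rewrite [leRHS]mulrA; apply: ler_wpM2r => //.
  rewrite expr2 mulrACA; exact: ler_pM.
apply: (@le_trans _ _ (gmax ^+ 2 * \sum_i \sum_j bulk i * bulk j * `|cov muN i j|)).
  by rewrite mulr_sumr; apply: ler_sum => i _; rewrite mulr_sumr; apply: ler_sum => j _.
apply: ler_wpM2l; first exact: sqr_ge0.
have K_gt0 : 0 < K%:R :> R by rewrite ltr0n.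
apply: (@le_trans _ _ (\sum_(i < n.+1) (bulk i
   + (\sum_(j < n.+1) bulk i * (bulk j * (j - p < K)%N%:R)
   + K%:R^-1 * \sum_(j < n.+1 | j != i) `|cov muN i j| * (p < i)%N%:R * (j - p)%N%:R)))).
  apply: ler_sum => i _.
  have b01 k : 0 <= bulk k <= 1 by rewrite /bulk; case: ltnP; rewrite ?lexx ler01.
  rewrite (bigD1 i) //= lerD //.
    have /andP[b0 b1] := b01 i.
    rewrite -[leRHS]mulr1 -mulrA ler_wpM2l // -[leRHS]mulr1 ler_pM //.
    exact: normr_cov_le1.
  have bulk_ge0 k : 0 <= bulk k by case/andP: (b01 k).
  rewrite [X in _ <= X + _](bigD1 i) //= -addrA -[leLHS]add0r lerD //.
    by rewrite !mulr_ge0.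
  rewrite mulr_sumr -big_split; apply: ler_sum => j ji /=.
  have [jK|Kj] := ltnP (j - p) K.
    rewrite mulr1 -[leLHS]addr0 lerD //.
    by rewrite -[leRHS]mulr1 ler_wpM2l ?mulr_ge0 // normr_cov_le1.
  rewrite !mulr0 add0r.
  have jK1 : 1 <= (j - p)%:R / K%:R :> R by rewrite ler_pdivlMr // mul1r ler_nat.
  have -> : K%:R^-1 * (`|cov muN i j| * (p < i)%N%:R * (j - p)%N%:R)
     = bulk i * `|cov muN i j| * ((j - p)%:R / K%:R) by rewrite /bulk; ring.
  rewrite mulrAC ler_wpM2l ?mulr_ge0 //; case/andP: (b01 j) => _ b1.
  exact: le_trans b1 jK1.
rewrite !big_split /= -mulr_sumr -natr1 mulrDr mulr1 [N%:R * _ + _]addrC -addrA.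
rewrite lerD // lerD //; last first.
  by rewrite mulrC ler_pM2r ?invr_gt0.
under eq_bigr do rewrite -mulr_sumr.
rewrite -mulr_suml; apply: ler_pM => //.
  by apply: sumr_ge0 => i _; rewrite /bulk.
by apply: sumr_ge0 => i _; rewrite mulr_ge0 // /bulk.
Qed.

(** The deviation is the fluctuation X around the stationary means plus a term of
    order 1/N.  The expectation of |X| is controlled by its second moment through
    |X| <= d/2 + X^2 / (2d) with d = eps/2, after choosing K, then N. *)
Lemma expect_deviation_small (mu : {ffun conf p -> R}) (G : R -> R) (gmax eps : R) :
  stationary (Ll r alpha c a) mu ->
  (forall x, 0 <= x <= 1 -> `|G x| <= gmax) -> 0 < eps ->
  exists N0, forall N, (N0 <= N)%N -> (2 <= N)%N ->
  forall muN : {ffun conf (p + N.-1) -> R},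
  stationary (@LN R p N beta r alpha c a) muN ->
  expect muN (@deviation R p N G
    (fun x => mean mu ord_max + (beta - mean mu ord_max) * x)) <= eps.
Proof.
move=> mu_stat G_le eps0.
have gmax_ge0 : 0 <= gmax by apply: le_trans (G_le 0 _); rewrite ?lexx ?ler01.
have [C1 C1_ge0 profileP] := profile_near_linear mu_stat.
have [C2 C2_ge0 momentP] := second_moment_bound.
have choose_nat (x : R) : exists m : nat, forall k, (m <= k)%N -> x <= k%:R.
  exists (Num.truncn x).+1 => k mk.
  by apply: le_trans (ltW (truncnS_gt x)) _; rewrite ler_nat.
have quotient_le (T e x : R) : 0 < e -> 0 < x -> T / e <= x -> T / x <= e.
  by move=> e0 x0; rewrite !ler_pdivrMr // mulrC.
have e2_gt0 : 0 < eps ^+ 2 / 8 by rewrite divr_gt0 ?exprn_gt0.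
have e1_gt0 : 0 < eps / 4 by rewrite divr_gt0.
have [K1 K1P] := choose_nat (gmax ^+ 2 * C2 / (eps ^+ 2 / 8)).
pose K := K1.+1; have K_ge := K1P K (leqnSn _).
have [N1 N1P] := choose_nat (gmax ^+ 2 * K.+1%:R / (eps ^+ 2 / 8)).
have [N2 N2P] := choose_nat (gmax * C1 / (eps / 4)).
exists (maxn N1 N2) => N; rewrite geq_max => /andP[/N1P N1_le /N2P N2_le].
move=> N_ge2 muN muN_stat.
have muN_prob : is_prob muN := muN_stat.1.
have N_gt0 : 0 < N%:R :> R by rewrite ltr0n ltnW.
have K_gt0 : 0 < K%:R :> R by rewrite ltr0n.
pose g (i : 'I_(p + N.-1).+1) : R := (p < i)%N%:R * G ((i - p)%N%:R / N%:R).
have in01 k : (k <= N)%N -> 0 <= (k%:R / N%:R : R) <= 1.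
  by move=> kN; rewrite divr_ge0 ?ler0n //= ler_pdivrMr // mul1r ler_nat.
have g_le i : `|g i| <= gmax * (p < i)%N%:R.
  by rewrite /g normrM normr_nat mulrC ler_wpM2r //; apply/G_le/in01/bulk_index_le.
pose X eta := N%:R^-1 * \sum_i g i * dev muN i eta.
pose err := gmax * C1 / N%:R.
have dev_le eta : @deviation R p N G
    (fun x => mean mu ord_max + (beta - mean mu ord_max) * x) eta <= `|X eta| + err.
  rewrite /deviation.
  set S := \sum_(1 <= k < N) _.
  have -> : S = \sum_i g i * dev muN i eta + \sum_(1 <= k < N) G (k%:R / N%:R) *
     (mean muN (inord (p + k)) - (mean mu ord_max + (beta - mean mu ord_max) * (k%:R / N%:R))).
    have -> : \sum_i g i * dev muN i eta
        = \sum_(1 <= k < N) G (k%:R / N%:R) * dev muN (inord (p + k)) eta.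
      rewrite bulk_sum ?(ltnW N_ge2) //; apply: eq_bigr => i _; rewrite /g.
      have [pi|_] := ltnP p i; last by rewrite !mul0r.
      by rewrite (subnKC (ltnW pi)) inord_val mulrA.
    by rewrite -big_split /=; apply: eq_bigr => k _; rewrite /dev; ring.
  rewrite mulrDr; apply: le_trans (ler_normD _ _) _; rewrite lerD //.
  rewrite normrM (ger0_norm (ltW _)) ?invr_gt0 // ler_pdivrMl //.
  rewrite /err mulrCA mulfV ?gt_eqF // mulr1.
  apply: le_trans (ler_norm_sum _ _ _) _.
  apply: (@le_trans _ _ (\sum_(1 <= k < N) gmax * (C1 / N%:R))).
    rewrite big_nat [leRHS]big_nat; apply: ler_sum => k /andP[_ kN].
    by rewrite normrM ler_pM ?profileP // G_le // in01 // ltnW.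
  rewrite sumr_const_nat -[leLHS]mulr_natr mulrA mulrAC ler_pdivrMr //.
  by rewrite ler_wpM2l ?mulr_ge0 // ler_nat leq_subr.
have X_le eta : `|X eta| <= (eps / 2) / 2 + X eta ^+ 2 / (eps / 2) / 2.
  have d0 : 0 < eps / 2 by rewrite divr_gt0.
  set d := eps / 2 in d0 *.
  have := sqr_ge0 (`|X eta| - d); rewrite sqrrB real_normK ?num_real // => sq.
  rewrite -(ler_pM2r d0) -subr_ge0.
  have -> : (d / 2 + X eta ^+ 2 / d / 2) * d - `|X eta| * d
     = (X eta ^+ 2 - `|X eta| * d *+ 2 + d ^+ 2) / 2.
    by rewrite -mulr_natr; field; rewrite gt_eqF.
  by rewrite divr_ge0.
have EX2 : expect muN (fun eta => X eta ^+ 2) <= gmax ^+ 2 * (K.+1%:R / N%:R + C2 / K%:R).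
  have -> : expect muN (fun eta => X eta ^+ 2)
     = (N%:R^-1) ^+ 2 * expect muN (fun eta => (\sum_i g i * dev muN i eta) ^+ 2).
    by rewrite -expectZ; apply: eq_expect => eta; rewrite exprMn.
  have := momentP N N_ge2 muN muN_stat g gmax g_le K isT.
  move/(ler_wpM2l (sqr_ge0 N%:R^-1)) => /le_trans; apply.
  rewrite le_eqVlt; apply/orP; left; apply/eqP; field.
  by rewrite !gt_eqF.
have : expect muN (@deviation R p N G
    (fun x => mean mu ord_max + (beta - mean mu ord_max) * x))
  <= eps / 4 + (eps / 2)^-1 / 2 * expect muN (fun eta => X eta ^+ 2) + err.
  rewrite -expectZ -[X in X + _ + _](expect_cst muN_prob) -[err](expect_cst muN_prob).
  rewrite -!expectD; apply: le_expect => // eta.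
  apply: le_trans (dev_le eta) _; rewrite lerD2r; apply: le_trans (X_le eta) _.
  rewrite le_eqVlt; apply/orP; left; apply/eqP; field.
  by rewrite gt_eqF.
move/le_trans; apply.
have err_le : err <= eps / 4 by apply: quotient_le.
have near_le : gmax ^+ 2 * K.+1%:R / N%:R <= eps ^+ 2 / 8 by apply: quotient_le.
have far_le : gmax ^+ 2 * C2 / K%:R <= eps ^+ 2 / 8 by apply: quotient_le.
have EX2_le : expect muN (fun eta => X eta ^+ 2) <= eps ^+ 2 / 4.
  by apply: le_trans EX2 _; rewrite mulrDr !mulrA; lra.
have : (eps / 2)^-1 / 2 * expect muN (fun eta => X eta ^+ 2) <= eps / 4.
  have -> : eps / 4 = (eps / 2)^-1 / 2 * (eps ^+ 2 / 4) by field; rewrite gt_eqF.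
  by rewrite ler_wpM2l // ltW // divr_gt0 // invr_gt0 divr_gt0.
lra.
Qed.
End Model.

(** * The Dirichlet problem on the unit interval *)

Section Laplace.
Variable R : realType.

Lemma affine_laplace_solution (u0 u1 : R) :
  laplace_solution u0 u1 (fun x => u0 + (u1 - u0) * x).
Proof.
have D (x : R) : is_derive x 1 (fun x => u0 + (u1 - u0) * x) (u1 - u0).
  have D : is_derive x 1 (cst u0 + (u1 - u0) *: (@id R)) (0 + (u1 - u0) *: (1 : R)).
    exact: is_deriveD.
  by rewrite add0r /GRing.scale /= mulr1 in D.
have D1 : derive1 (fun x => u0 + (u1 - u0) * x) = fun=> u1 - u0.
  by apply/funext => x; rewrite derive1E; apply: derive_val.
split.
- by apply: derivable_within_continuous => x _; apply: ex_derive.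
- move=> x _; rewrite D1; split.
  + exact: ex_derive.
  + exact: derivable_cst.
  + by rewrite derive1E derive_cst.
- by rewrite mulr0 addr0.
- by rewrite mulr1 addrC subrK.
Qed.

(** The mean value theorem, applied to v', shows that v' is constant inside; applied
    to v on [0, x], where continuity at 0 is used, it shows that v is affine. *)
Lemma laplace_solution_affine (u0 u1 : R) (v : R -> R) :
  laplace_solution u0 u1 v -> forall x, 0 <= x <= 1 -> v x = u0 + (u1 - u0) * x.
Proof.
move=> [v_cont v_harm v0 v1].
have slope_cst x y : 0 < x -> x < y -> y < 1 -> derive1 v x = derive1 v y.
  move=> x0 xy y1.
  have D z : z \in `[x, y]%R -> is_derive z 1 (derive1 v) (0 : R).
    rewrite in_itv /= => /andP[xz zy].
    have [|_ dz <-] := v_harm z; first by rewrite (lt_le_trans x0) ?(le_lt_trans zy).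
    by rewrite derive1E; apply: DeriveDef.
  have D' z : z \in `]x, y[%R -> is_derive z 1 (derive1 v) ((fun=> 0 : R) z).
    by move=> /subset_itv_oo_cc; apply: D.
  have cont : {within `[x, y], continuous (derive1 v)}.
    by apply: derivable_within_continuous => z /D dz; exact: (@ex_derive _ _ _ _ _ _ _ dz).
  have [c _] := @MVT R (derive1 v) (fun=> 0) x y xy D' cont.
  by rewrite mul0r => /subr0_eq.
have slope_eq x y : 0 < x < 1 -> 0 < y < 1 -> derive1 v x = derive1 v y.
  move=> /andP[? ?] /andP[? ?]; have [xy|yx|->//] := ltgtP x y.
    exact: slope_cst.
  by symmetry; apply: slope_cst.
have chord x : 0 < x <= 1 -> v x = u0 + derive1 v (2^-1) * x.
  move=> /andP[x0 x1].
  have [z||c] := @MVT _ v (derive1 v) 0 x x0.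
  - rewrite in_itv /= => /andP[z0 zx].
    have [|dz _ _] := v_harm z; first by rewrite z0 (lt_le_trans zx).
    by rewrite derive1E; apply: DeriveDef.
  - apply: continuous_subspaceW v_cont; apply: subset_itvl; exact: x1.
  - rewrite in_itv /= => /andP[c0 cx]; rewrite v0 subr0 => E.
    rewrite (@slope_eq _ c) ?c0 ?(lt_le_trans cx) //; last by apply/andP; split; lra.
    by rewrite -E addrC subrK.
have slopeE : derive1 v (2^-1) = u1 - u0.
  have := chord 1; rewrite v1 mulr1 ltr01 lexx => ->//; ring.
move=> x /andP[]; rewrite le_eqVlt => /orP[/eqP<- _|x0 x1].
  by rewrite v0 mulr0 addr0.
by rewrite chord ?x0 // slopeE.
Qed.

Lemma continuous_bounded01 (G : R -> R) : {within `[0, 1], continuous G} ->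
  exists gmax : R, forall x, 0 <= x <= 1 -> `|G x| <= gmax.
Proof.
move=> G_cont; have absG_cont : {within `[0, 1], continuous (fun x => `|G x|)}.
  by move=> x; apply: continuous_comp (G_cont x) _; apply: norm_continuous.
have [z _ z_max] := EVT_max ler01 absG_cont.
by exists `|G z| => x x01; apply: z_max; rewrite in_itv.
Qed.
End Laplace.

(** * The hydrostatic limit *)

Theorem theorem2p1 (R : realType) (p : nat) (beta : R)
    (r alpha : 'I_p.+1 -> R) (c a : 'I_p.+1 -> 'I_p.+1 -> R)
    (hbeta : 0 < beta < 1)
    (hr : forall j, 0 <= r j)
    (halpha : forall j, 0 <= alpha j <= 1)
    (hc : forall j k, 0 <= c j k) (hc0 : forall j, c j j = 0)
    (ha : forall j k, 0 <= a j k) (ha0 : forall j, a j j = 0)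
    (hsum : 0 < \sum_(j < p.+1) r j) :
  [/\ exists! mu : {ffun conf p -> R}, stationary (Ll r alpha c a) mu,
      forall N : nat, (2 <= N)%N ->
        exists! muN : {ffun conf (p + N.-1) -> R},
          stationary (@LN R p N beta r alpha c a) muN
    & forall (mu : {ffun conf p -> R})
             (muN : forall N : nat, {ffun conf (p + N.-1) -> R}),
        stationary (Ll r alpha c a) mu ->
        (forall N : nat, (2 <= N)%N ->
           stationary (@LN R p N beta r alpha c a) (muN N)) ->
        exists ubar : R -> R,
          [/\ laplace_solution (expect mu (fun eta => occ R eta ord_max)) beta ubar,
              forall v : R -> R,
                laplace_solution (expect mu (fun eta => occ R eta ord_max)) beta v ->
                forall x : R, 0 <= x <= 1 -> v x = ubar x
            & forall G : R -> R, {within `[0, 1], continuous G} ->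
                (fun N : nat => expect (muN N) (@deviation R p N G ubar)) @ \oo
                  --> (0 : R)]].
Proof.
split; first exact: left_unique_stationary.
  by move=> N; exact: full_unique_stationary.
move=> mu muN mu_stat muN_stat.
exists (fun x => expect mu (fun eta => occ R eta ord_max)
          + (beta - expect mu (fun eta => occ R eta ord_max)) * x); split.
- exact: affine_laplace_solution.
- exact: laplace_solution_affine.
move=> G /continuous_bounded01[gmax G_le]; apply/cvgrPdist_le => eps eps0.
have [N0 N0P] := expect_deviation_small hbeta hr hc ha hsum mu_stat G_le eps0.
near=> N.
have N_ge2 : (2 <= N)%N by near: N; exact: nbhs_infty_ge.
rewrite sub0r normrN ger0_norm; last first.
  apply: expect_ge0; first exact: (muN_stat N N_ge2).1.
  by move=> eta; exact: normr_ge0.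
apply: N0P => //; last exact: muN_stat.
by near: N; exact: nbhs_infty_ge.
Unshelve. all: by end_near. Qed.
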